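(* Let $q$ be a power of an odd prime with $q\equiv 3\pmod 4$, let $m$ be an even positive integer, and let $V$ be a $2m$-dimensional vector space over $\mathbb{F}_q$ with a non-degenerate alternating bilinear form $f$. Let $G$ be a solvable subgroup of $\mathrm{Sp}(V)\cong \mathrm{Sp}(2m,q)$ that acts transitively on a complete symplectic spread of $V$. Then there is at least one Zsigmondy prime divisor $r$ of $q^{2m}-1$ such that a Sylow $r$-subgroup of $G$ is normal in $G$.
   Context: A prime $r$ is a Zsigmondy prime divisor of $q^i-1$ if $r$ divides $q^i-1$ but does not divide $q^j-1$ for $1\leq j<i$. A subspace is totally isotropic if $f$ vanishes on it. A complete symplectic spread of $V$ is a collection of $q^m+1$ totally isotropic $m$-dimensional subspaces whose union is $V$ and which intersect pairwise trivially. $\mathrm{Sp}(V)$ is the isometry group of $f$. *)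

(* Defs.v *)
From HB Require Import structures.
From mathcomp Require Import all_boot all_order all_fingroup all_algebra.
From mathcomp Require Import all_solvable all_field.

Set Implicit Arguments.
Unset Strict Implicit.
Unset Printing Implicit Defensive.

Import GRing.Theory.
Local Open Scope ring_scope.

Definition zsigmondy_prime (q i r : nat) : Prop :=
  [/\ prime r, (r %| q ^ i - 1)%N
    & forall j : nat, (1 <= j < i)%N -> ~~ (r %| q ^ j - 1)%N].

Section Forms.

Variables (F : finFieldType) (V : vectType F) (f : {biscalar V}).

Definition alternating_form : Prop := forall u : V, f u u = 0.

(* For the alternating forms considered here the left and right radicals
   coincide, so one side suffices. *)
Definition nondegenerate_form : Prop :=
  forall u : V, (forall v : V, f u v = 0) -> u = 0.

Definition totally_isotropic (W : {vspace V}) : Prop :=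
  {in W &, forall u v, f u v = 0}.

(* [finvect_type V] is [V] itself, with its finite type structure; linear
   automorphisms of V are represented as permutations of its vectors. *)
Definition Sp : {set {perm finvect_type V}} :=
  [set s : {perm finvect_type V} |
     [forall a : F, forall u, forall v, s (a *: u + v) == a *: s u + s v]
     && [forall u, forall v, f (s u) (s v) == f u v]].

Lemma SpP (s : {perm finvect_type V}) :
  reflect (linear s /\ (forall u v, f (s u) (s v) = f u v)) (s \in Sp).
Proof.
rewrite inE; apply: (iffP andP) => [[/forallP L /forallP I] | [L I]]; split.
- by move=> a u v; have /forallP/(_ u)/forallP/(_ v)/eqP := L a.
- by move=> u v; have /forallP/(_ v)/eqP := I u.
- by apply/forallP=> a; apply/forallP=> u; apply/forallP=> v; apply/eqP/L.
- by apply/forallP=> u; apply/forallP=> v; apply/eqP/I.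
Qed.

Lemma Sp_group_set : group_set Sp.
Proof.
apply/group_setP; split=> [|s t /SpP[sL sI] /SpP[tL tI]]; apply/SpP.
  by split=> [a u v|u v]; rewrite !perm1.
by split=> [a u v|u v]; rewrite !permM ?sL ?tL ?tI ?sI.
Qed.

Canonical Sp_group := Group Sp_group_set.

(* The members of a spread are subspaces given by their sets of vectors, on
   which permutations act by ['P^*]. *)
Definition complete_symplectic_spread (m : nat)
    (S : {set {set finvect_type V}}) : Prop :=
  [/\ #|S| = (#|F| ^ m + 1)%N,
      forall U, U \in S -> exists W : {vspace V},
        [/\ U = [set v : finvect_type V | (v : V) \in W], \dim W = m & totally_isotropic W],
      cover S = [set: finvect_type V]
    & {in S &, forall U1 U2, U1 != U2 -> U1 :&: U2 = [set 0]}].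

End Forms.

(* Main.v *)
(* The idea. Let n = 2m. A Zsigmondy prime r of q^n - 1 exists because the
   value of the n-th cyclotomic polynomial at q exceeds every prime factor of n,
   and r divides q^m + 1, hence |G|. An element z of order r acts irreducibly.
   Take z in the centre of a Sylow r-subgroup P. If z centralises the Fitting
   subgroup of G, then z lies in O_r(G), <z> is normal in G, and P lies in the
   abelian normal subgroup C_G(z). Otherwise z does not centralise some
   T = O_s(G), and E = [T, z] is extraspecial. Comparing |E : Z(E)| with n^2
   yields s = 2 and |E : Z(E)| = n^2. As T is a normal 2-subgroup of G and
   |S| = q^m + 1 = 2 mod 4, the orbits of T on the spread have length at most 2,
   so a member U of the spread has a stabiliser B of index at most 2 in E. The
   group B is so large that some y in Z(B) \ Z(E) acts on U as a scalar, which
   is 1 or -1 because q = 3 mod 4; together with another member of the spread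
   in the E-orbit of U this makes f degenerate. *)

Require Import Defs.
From mathcomp Require Import all_boot all_order all_fingroup all_algebra.
From mathcomp Require Import all_solvable all_field.
From mathcomp Require Import zify ring.
Set Implicit Arguments.
Unset Strict Implicit.
Unset Printing Implicit Defensive.
Import Order.TTheory GRing.Theory Num.Theory.

(** * Existence of Zsigmondy primes through cyclotomic values *)

Lemma dvdn_exp_sub1 q k r : 0 < q -> (r %| q ^ k - 1) = (q ^ k == 1 %[mod r]).
Proof. by move=> q_gt0; rewrite eqn_mod_dvd // expn_gt0 q_gt0. Qed.

(** [d] is the multiplicative order of [q] modulo [r]. *)
Lemma order_modP q r n : 0 < q -> 0 < n -> r %| q ^ n - 1 ->
  exists2 d, 0 < d & forall k, (r %| q ^ k - 1) = (d %| k).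
Proof.
move=> q_gt0 n_gt0 rn.
have ex : exists k, (0 < k) && (r %| q ^ k - 1) by exists n; rewrite n_gt0.
case: (ex_minnP ex) => d /andP[d_gt0 rd] dmin; exists d => // k.
move: rd; rewrite !dvdn_exp_sub1 // => /eqP rd.
have -> : q ^ k = q ^ (k %% d) %[mod r].
  rewrite {1}(divn_eq k d) expnD [k %/ d * d]mulnC expnM.
  by rewrite -modnMml -modnXm rd modnXm exp1n modnMml mul1n.
rewrite /dvdn; have [->|lt0] := posnP (k %% d); first by rewrite expn0 eqxx.
apply/negbTE/negP => h.
have := dmin (k %% d); rewrite lt0 dvdn_exp_sub1 // h => /(_ isT).
by rewrite leqNgt ltn_mod d_gt0.
Qed.

Lemma geom_sum q a s : (\sum_(i < s) (q ^ a) ^ i) * (q ^ a - 1) = q ^ (a * s) - 1.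
Proof. by rewrite [q ^ (a * s)]expnM !subn1 [RHS]predn_exp mulnC. Qed.

(** With [Q = t * r + 1], the sum is [r + t * r * (r * (r - 1) / 2)] modulo [r ^ 2]; as [r] is odd,
    only [r] remains. *)
Lemma sqr_ndvd_geom_sum Q r : prime r -> odd r -> Q = 1 %[mod r] ->
  ~~ (r ^ 2 %| \sum_(i < r) Q ^ i).
Proof.
move=> r_pr r_odd Q1; have r_gt1 := prime_gt1 r_pr.
have [t ->] : exists t, Q = t * r + 1.
  by exists (Q %/ r); rewrite {1}(divn_eq Q r) Q1 modn_small.
have E i : exists u, (t * r + 1) ^ i = u * r ^ 2 + i * (t * r) + 1.
  elim: i => [|i [u IH]]; first by exists 0; rewrite expn0.
  exists (u * (t * r + 1) + i * t ^ 2); rewrite expnSr IH; ring.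
have S n : exists u, \sum_(i < n) (t * r + 1) ^ i =
    u * r ^ 2 + (\sum_(i < n) i) * (t * r) + n.
  elim: n => [|k [u IH]]; first by exists 0; rewrite !big_ord0.
  have [v Ev] := E k; exists (u + v).
  rewrite !big_ord_recr /= IH Ev; ring.
have [u Eu] := S r.
rewrite Eu; have G n : (\sum_(i < n) i) * 2 = n * n.-1.
  elim: n => [|n IH]; first by rewrite big_ord0.
  by rewrite big_ord_recr /= mulnDl IH; case: n {IH} => //= n; ring.
have -> : \sum_(i < r) i = r * r.-1./2.
  have h : r.-1 = r.-1./2 * 2 by lia.
  by apply/eqP; rewrite -(eqn_pmul2r (isT : 0 < 2)) G -mulnA -h.
have -> : u * r ^ 2 + r * r.-1./2 * (t * r) + r = (u + r.-1./2 * t) * r ^ 2 + r by ring.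
rewrite dvdn_addr; last exact: dvdn_mull.
apply/negP => h; have := dvdn_leq (ltnW r_gt1) h.
by rewrite leqNgt -[X in X < _]expn1 ltn_exp2l.
Qed.

Lemma totient_ge_prime r n : 0 < n -> prime r -> r %| n -> r.-1 <= totient n.
Proof.
move=> n_gt0 r_pr rn; have [a [k [co E]]] : exists a k, coprime r k /\ n = k * r ^ a.+1.
  have [k co E] := pfactor_coprime r_pr n_gt0.
  have: 0 < logn r n by rewrite logn_gt0 mem_primes r_pr n_gt0.
  by case: (logn r n) E => // a E _; exists a, k.
rewrite E totient_coprime; last by rewrite coprime_sym coprimeXl.
rewrite totient_pfactor //= mulnCA -[X in X <= _]muln1 leq_mul2l.
rewrite muln_gt0 totient_gt0 expn_gt0 (prime_gt0 r_pr) /= andbT orbC.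
by move: n_gt0; rewrite E muln_gt0 => /andP[-> _].
Qed.

Local Open Scope ring_scope.

(** Factor ['X^n - 1] into the ['Phi_d] with [d %| n]: the [d] dividing [n %/ s], of which [n] is
    not one, give ['X^(n %/ s) - 1], and [R] collects the rest. *)
Lemma Cyclotomic_dvd n s : (0 < n)%N -> prime s -> (s %| n)%N ->
  exists R : {poly int}, 'X^n - 1 = 'Phi_n * ('X^(n %/ s) - 1) * R.
Proof.
move=> n_gt0 s_pr sn.
have k_gt0 : (0 < n %/ s)%N by rewrite divn_gt0 ?prime_gt0 // dvdn_leq.
rewrite -!prod_Cyclotomic // (bigID (fun d => d %| n %/ s)%N) /=.
rewrite -big_filter -[X in _ * X]big_filter.
exists (\prod_(d <- [seq d <- divisors n | ~~ (d %| n %/ s)%N & d != n]) 'Phi_d).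
rewrite mulrAC mulrC; congr (_ * _).
  rewrite (big_rem n) /=; last first.
    rewrite mem_filter -dvdn_divisors // dvdnn andbT.
    by rewrite gtnNdvd // ltn_Pdiv // prime_gt1.
  congr (_ * _); rewrite rem_filter ?filter_uniq ?divisors_uniq //.
  by rewrite -filter_predI; congr bigop; apply: eq_filter => d /=; rewrite andbC.
apply: perm_big; apply: uniq_perm; rewrite ?filter_uniq ?divisors_uniq // => d.
rewrite mem_filter -!dvdn_divisors //; apply: andb_idr => /dvdn_trans; apply.
by rewrite dvdn_div.
Qed.

(** Over [algC] each factor [q - z ^+ k] has norm at least [q - 1], hence at least 2. *)
Lemma Cyclotomic_norm_ge n q : (0 < n)%N -> (2 < q)%N ->
  (2 ^ totient n <= `|('Phi_n).[q%:Z]|)%N.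
Proof.
move=> n_gt0 q_gt2; have [z zP] := C_prim_root_exists n_gt0.
have E : ('Phi_n).[q%:Z]%:~R = \prod_(k < n | coprime k n) (q%:R - z ^+ k) :> algC.
  rewrite -(horner_map (intr : {rmorphism int -> algC})) /= (Cintr_Cyclotomic zP) /cyclotomic.
  by rewrite horner_prod; apply: eq_bigr => k _; rewrite hornerXsubC.
have z1 : `|z| = 1 :> algC.
  by apply/eqP; rewrite -(pexpr_eq1 n_gt0) // -normrX (prim_expr_order zP) normr1.
rewrite -(ler_nat algC) natr_absz intr_norm E normr_prod natrX.
have -> : totient n = #|[pred k : 'I_n | coprime k n]|.
  rewrite totient_count_coprime -big_mkcond big_mkord -sum1_card.
  by apply: eq_bigl => k; rewrite coprime_sym.
rewrite -prodr_const ler_prod // => k _; rewrite ler0n /=.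
apply: le_trans (lerB_dist _ _); rewrite normr_nat normrX z1 expr1n.
by rewrite lerBrDr natr1 ler_nat.
Qed.

(** The sum is the value at [q] of the quotient of ['X^n - 1] by ['X^(n %/ s) - 1]. *)
Lemma Cyclotomic_dvd_geom_sum n q s : (0 < n)%N -> (1 < q)%N -> prime s -> (s %| n)%N ->
  (`|('Phi_n).[q%:Z]| %| \sum_(i < s) (q ^ (n %/ s)) ^ i)%N.
Proof.
move=> n_gt0 q_gt1 s_pr sn; have [R] := Cyclotomic_dvd n_gt0 s_pr sn.
move/(congr1 (fun P => `|P.[q%:Z]|%N)).
have D k : `|('X^k - 1 : {poly int}).[q%:Z]|%N = (q ^ k - 1)%N.
  rewrite hornerD hornerN hornerXn hornerC -natz -natrX -[1]/(1%:R) -natrB ?expn_gt0 ?(ltnW q_gt1) //.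
  by rewrite natz.
rewrite !hornerM !abszM !D -{1}(divnK sn) -geom_sum => E.
have k_gt0 : (0 < q ^ (n %/ s) - 1)%N.
  by rewrite subn_gt0 -(expn0 q) ltn_exp2l // divn_gt0 ?prime_gt0 // dvdn_leq.
by rewrite -(dvdn_pmul2r k_gt0) E; apply: dvdn_mulr.
Qed.

Local Close Scope ring_scope.

Lemma coprime_of_dvd_exp_sub1 q n r : 0 < q -> 0 < n -> prime r ->
  r %| q ^ n - 1 -> coprime q r.
Proof.
move=> q_gt0 n_gt0 r_pr rn; rewrite coprime_sym prime_coprime //; apply/negP => rq.
have : r %| q ^ n by apply: dvdn_trans rq _; rewrite -{1}[q]expn1 dvdn_exp2l.
rewrite -[q ^ n](subnK (_ : 0 < q ^ n)) ?expn_gt0 ?q_gt0 // dvdn_addr //.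
by rewrite dvdn1 => /eqP r1; rewrite r1 in r_pr.
Qed.

(* A prime [r] dividing ['Phi_n(q)] that is not a Zsigmondy prime is the only
   prime divisor of [n] that does not divide [r - 1]. *)
Lemma dvd_Cyclotomic_cases n q r : 4 %| n -> 0 < n -> 2 < q -> odd q ->
    prime r -> r %| `|('Phi_n).[q%:Z]%R| ->
  zsigmondy_prime q n r \/
  [/\ r %| n, ~~ (r ^ 2 %| `|('Phi_n).[q%:Z]%R|)
    & exists2 d, d %| r.-1 & forall s, prime s -> s %| n -> s = r \/ s %| d].
Proof.
move=> n4 n_gt0 q_gt2 q_odd r_pr rN.
have q_gt1 := ltnW q_gt2; have q_gt0 := ltnW q_gt1.
have rS s : prime s -> s %| n -> r %| \sum_(i < s) (q ^ (n %/ s)) ^ i.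
  by move=> s_pr sn; apply: dvdn_trans rN (Cyclotomic_dvd_geom_sum _ _ _ _).
have rn : r %| q ^ n - 1.
  have n2 : 2 %| n by apply: dvdn_trans n4.
  by rewrite -{1}(divnK n2) -geom_sum dvdn_mulr ?rS.
have [d d_gt0 dP] := order_modP q_gt0 n_gt0 rn.
have dn : d %| n by rewrite -dP.
have [n_le_d|lt_dn] := leqP n d.
  left; split => // j /andP[j_gt0 ltj]; rewrite dP gtnNdvd //.
  exact: leq_trans n_le_d.
right.
have quot_dvd s : prime s -> s %| n %/ d -> d %| n %/ s.
  move=> s_pr sd; have sn : s %| n by apply: dvdn_trans sd (dvdn_div dn).
  rewrite -(dvdn_pmul2l (prime_gt0 s_pr)) [s * (_ %/ _)]mulnC (divnK sn).
  by rewrite -{1}(divnK dn) dvdn_pmul2r.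
(* As [d %| n %/ s], every term of the geometric sum is 1 modulo [r], so the sum is [s] modulo [r],
   and [r] divides [s]. *)
have primes_quot s : prime s -> s %| n %/ d -> s = r.
  move=> s_pr sd.
  have sn : s %| n by apply: dvdn_trans sd (dvdn_div dn).
  have: r %| s.
    have := rS s s_pr sn; have : r %| q ^ (n %/ s) - 1 by rewrite dP quot_dvd.
    rewrite dvdn_exp_sub1 // => /eqP Q1.
    rewrite /dvdn -modn_summ (eq_bigr (fun=> 1 %% r)); last first.
      by move=> i _; rewrite -modnXm Q1 modnXm exp1n.
    by rewrite modn_summ sum1_card card_ord.
  by rewrite dvdn_prime2 // => /eqP.
have rd : r %| n %/ d.
  have: 1 < n %/ d by rewrite ltn_divRL // mul1n.
  by move=> h; rewrite -(primes_quot (pdiv (n %/ d))) ?pdiv_prime ?pdiv_dvd.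
have rn' : r %| n by apply: dvdn_trans rd (dvdn_div dn).
split=> //; last first.
- exists d.
    rewrite -dP dvdn_exp_sub1 // -totient_prime //; apply/eqP/Euler_exp_totient.
    exact: coprime_of_dvd_exp_sub1 rn.
  move=> s s_pr; rewrite -{1}(divnK dn) Euclid_dvdM // => /orP[/primes_quot|]; auto.
apply/negP => /dvdn_trans/(_ (Cyclotomic_dvd_geom_sum n_gt0 q_gt1 r_pr rn')).
have [r2|r_odd] := even_prime r_pr; last first.
  apply/negP/sqr_ndvd_geom_sum => //; apply/eqP; rewrite -dvdn_exp_sub1 // dP.
  exact: quot_dvd.
(* For [r = 2] the sum is [1 + q ^ (n %/ 2)]; as [4 %| n], this is 1 plus an odd square, so 2 modulo
   4. *)
rewrite r2 !big_ord_recr big_ord0 /= expn0 expn1 add0n.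
have -> : q ^ (n %/ 2) = (q ^ (n %/ 4)) ^ 2.
  rewrite -expnM; congr (q ^ _); apply/eqP; rewrite -(eqn_pmul2r (isT : 0 < 2)) -mulnA (divnK n4).
  by rewrite divnK // (dvdn_trans _ n4).
have : odd (q ^ (n %/ 4)) by rewrite oddX q_odd orbT.
move: (q ^ _) => x x_odd; rewrite -(odd_double_half x) x_odd -muln2.
have -> : 1 + (true + x./2 * 2) ^ 2 = (x./2 ^ 2 + x./2) * 2 ^ 2 + 2 by rewrite /=; ring.
by rewrite dvdn_addr; last exact: dvdn_mull.
Qed.

(** A prime factor [r] of [N] that is not a Zsigmondy prime divides [N] only once. If [N = r], then
    [2 ^ totient n <= r <= 2 ^ r.-1 <= 2 ^ totient n] makes [r] a power of 2, so 2, which is too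
    small. Otherwise [N %/ r] has a prime factor [r'] other than [r]; were it exceptional too, each
    of [r] and [r'] would be less than the other. *)
Lemma zsigmondy_exists q n : 2 < q -> odd q -> 0 < n -> 4 %| n ->
  exists r, zsigmondy_prime q n r.
Proof.
move=> q_gt2 q_odd n_gt0 n4; set N := `|('Phi_n).[q%:Z]%R|.
have geN : 2 ^ totient n <= N := Cyclotomic_norm_ge n_gt0 q_gt2.
have phi_gt1 : 1 < totient n by rewrite totient_gt1; apply: leq_trans (dvdn_leq n_gt0 n4).
have N_gt1 : 1 < N.
  by apply: leq_trans geN; rewrite -(expn0 2) ltn_exp2l // ltnW.
have r_pr := pdiv_prime N_gt1; have rN := pdiv_dvd N.
move: (pdiv N) r_pr rN => r r_pr rN.
have [|[rn r2N [d dr dP]]] := dvd_Cyclotomic_cases n4 n_gt0 q_gt2 q_odd r_pr rN.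
  by exists r.
have [c1|c_neq1] := eqVneq (N %/ r) 1.
  have Nr : N = r by rewrite -(divnK rN) -/N c1 mul1n.
  have r_le : r <= 2 ^ totient n.
    rewrite -(prednK (prime_gt0 r_pr)); apply: leq_trans (ltn_expl r.-1 (isT : 1 < 2)) _.
    by rewrite leq_exp2l // totient_ge_prime.
  have E : r = 2 ^ totient n by apply/eqP; rewrite eqn_leq r_le -[X in _ <= X]Nr geN.
  have r2 : r = 2.
    by apply/eqP; rewrite eq_sym -dvdn_prime2 // E -{1}(expn1 2) dvdn_exp2l // ltnW.
  have: 2 ^ 1 < 2 ^ totient n by rewrite ltn_exp2l.
  by rewrite -E r2.
have c_gt1 : 1 < N %/ r.
  by rewrite ltn_neqAle eq_sym c_neq1 divn_gt0 ?prime_gt0 // dvdn_leq // ltnW.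
have r'_pr := pdiv_prime c_gt1; have r'c := pdiv_dvd (N %/ r).
move: (pdiv (N %/ r)) r'_pr r'c => r' r'_pr r'c.
have r'N : r' %| N := dvdn_trans r'c (dvdn_div rN).
have [|[r'n r'2N [d' d'r' d'P]]] := dvd_Cyclotomic_cases n4 n_gt0 q_gt2 q_odd r'_pr r'N.
  by exists r'.
have neq : r' <> r.
  move=> E; case/negP: r2N; rewrite -/N -(divnK rN) -/N -mulnn dvdn_pmul2r ?prime_gt0 //.
  by rewrite -{1}E.
have lt_prime s t e : prime s -> prime t -> e %| t.-1 -> s %| e -> s < t.
  move=> s_pr t_pr et se; rewrite -ltnS -[t in _ < t.+1](prednK (prime_gt0 t_pr)) ltnS.
  apply: leq_ltn_trans (dvdn_leq _ (dvdn_trans se et)) _ => //.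
  by case: t t_pr {et} => [|[]].
have [] := dP r' r'_pr r'n => // /(lt_prime _ _ _ r'_pr r_pr dr) lt1.
have [E|] := d'P r r_pr rn; first by case: neq.
by move/(lt_prime _ _ _ r_pr r'_pr d'r'); rewrite ltnNge ltnW.
Qed.

Local Open Scope ring_scope.

(** * Linear permutations and their invariant subspaces *)

Section LinearGroups.

Variables (F : finFieldType) (V : vectType F).
Local Notation VV := (finvect_type V).
Implicit Types (A : {set VV}) (v u w : VV) (s t z : {perm VV}).

(** The general linear group, in the encoding of [Sp]. *)
Definition linear_perms : {set {perm VV}} :=
  [set s : {perm VV} |
     [forall a : F, forall u, forall v, s (a *: u + v) == a *: s u + s v]].

Lemma linear_permsP s : reflect (linear s) (s \in linear_perms).
Proof.
rewrite inE; apply: (iffP forallP) => L a.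
  by move=> u v; have /forallP/(_ u)/forallP/(_ v)/eqP := L a.
by apply/forallP=> u; apply/forallP=> v; apply/eqP/L.
Qed.

Lemma linear_perms_group_set : group_set linear_perms.
Proof.
apply/group_setP; split=> [|s t /linear_permsP sL /linear_permsP tL].
  by apply/linear_permsP=> a u v; rewrite !perm1.
by apply/linear_permsP=> a u v; rewrite !permM sL tL.
Qed.

Canonical linear_perms_group := Group linear_perms_group_set.

Section Evaluation.

Variables (s : {perm VV}) (sL : s \in linear_perms).

Lemma linD u v : s (u + v) = s u + s v.
Proof. by have /linear_permsP/(_ 1 u v) := sL; rewrite !scale1r. Qed.

Lemma lin0 : s 0 = 0.
Proof. by apply: (addrI (s 0)); rewrite -linD !addr0. Qed.

Lemma linZ a u : s (a *: u) = a *: s u.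
Proof. by have /linear_permsP/(_ a u 0) := sL; rewrite lin0 !addr0. Qed.

Lemma lin_sum I r (P : pred I) (E : I -> VV) :
  s (\sum_(i <- r | P i) E i) = \sum_(i <- r | P i) s (E i).
Proof. exact: (big_morph _ linD lin0). Qed.

End Evaluation.

Lemma submod_sum A I r (P : pred I) (E : I -> VV) : GRing.submod_closed A ->
  (forall i, P i -> E i \in A) -> \sum_(i <- r | P i) E i \in A.
Proof.
case=> A0 AL AE; elim/big_rec: _ => // i x Pi Ax.
by rewrite -[E i]scale1r AL ?AE.
Qed.

(** Subspaces occur below as sets of vectors, on which permutations act; this gives them a
    dimension. *)
Lemma submod_vspace A : GRing.submod_closed A -> exists W : {vspace VV}, A =i W.
Proof.
move=> Amod; exists <<enum A>>%VS => v; apply/idP/idP=> [vA|].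
  by apply: memv_span; rewrite mem_enum.
move/(@coord_span _ _ _ (in_tuple (enum A))) ->.
apply: submod_sum => // i _; case: (Amod) => A0 AL.
rewrite -[_ *: _]addr0 AL // -mem_enum; apply: mem_nth.
by case: i => /= i.
Qed.

Lemma card_submod A : GRing.submod_closed A ->
  exists2 d, #|A| = (#|F| ^ d)%N & (d <= \dim {:V})%N.
Proof.
case/submod_vspace=> W defA; exists (\dim W); last first.
  by have := @dimvS F VV W fullv (subvf W).
by rewrite (eq_card defA) card_vspace.
Qed.

Lemma submod_neq0 A : GRing.submod_closed A -> (1 < #|A|)%N -> exists2 v, v \in A & v != 0.
Proof.
case=> A0 _; rewrite (cardsD1 0) A0 ltnS => /card_gt0P[v].
by rewrite !inE => /andP[v0 vA]; exists v.
Qed.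

Lemma card_finvect : #|[set: VV]| = (#|F| ^ \dim {:V})%N.
Proof.
have -> : #|[set: VV]| = #|({:VV}%VS : {vspace VV})|.
  by apply: eq_card => v; rewrite inE memvf.
by rewrite card_vspace.
Qed.

Lemma submod_afix (H : {set {perm VV}}) A : H \subset linear_perms ->
  GRing.submod_closed A -> GRing.submod_closed 'Fix_(A | 'P)(H)%g.
Proof.
move=> /subsetP HL [A0 AL]; split=> [|a u v].
  by rewrite inE A0; apply/afixP=> s /HL sL; rewrite /= apermE lin0.
move=> /setIP[uA /afixP uH] /setIP[vA /afixP vH]; rewrite inE AL //=.
apply/afixP=> s Hs; rewrite /= apermE linD ?linZ ?HL //.
by have /= := uH s Hs; have /= := vH s Hs; rewrite !apermE => -> ->.
Qed.

Lemma submodT : GRing.submod_closed [set: VV].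
Proof. by split=> [|a u v _ _]; rewrite inE. Qed.

(** * Irreducibility of an element of Zsigmondy prime order *)

Section ZsigmondyElement.

Variables (r : nat) (z : {perm VV}).
Hypotheses (zL : z \in linear_perms) (oz : #[z]%g = r).
Hypothesis rP : zsigmondy_prime #|F| (\dim {:V}) r.
Let n := \dim {:V}.
Let q := #|F|.

Let q_gt1 : (1 < q)%N := card_finNzRing_gt1 F.
Let r_pr : prime r. Proof. by case: rP. Qed.

Let z_rgroup : (r.-group <[z]>)%g.
Proof. by rewrite /pgroup -orderE oz pnat_id. Qed.

Let exp_r_cond d : (d <= n)%N -> q ^ d = 1 %[mod r] -> d = 0%N \/ d = n.
Proof.
move=> le_dn /eqP; rewrite -dvdn_exp_sub1 ?(ltnW q_gt1) // => rd.
have [->|d_gt0] := posnP d; first by left.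
right; apply/eqP; rewrite eqn_leq le_dn leqNgt; apply/negP=> lt_dn.
by have [_ _ /(_ d)] := rP; rewrite d_gt0 lt_dn rd => /(_ isT).
Qed.

Let expn_r : q ^ n = 1 %[mod r].
Proof. by apply/eqP; rewrite -dvdn_exp_sub1 ?(ltnW q_gt1) //; case: rP. Qed.

Lemma mem_afix_cycle v : (v \in 'Fix_('P)(<[z]>))%g = (z v == v).
Proof. by rewrite afix_cycle; apply/afix1P/eqP. Qed.

(** The fixed vectors form a subspace of [q ^ d] elements, and [q ^ d = q ^ n = 1] modulo [r]. As
    [q] has order [n] modulo [r], either [d = 0], or [d = n] and [z = 1], which is absurd. *)
Lemma zsigmondy_fix v : z v = v -> v = 0.
Proof.
move=> zv; have acts_z : [acts <[z]>, on [set: VV] | 'P]%g.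
  by apply/actsP=> s _ u; rewrite !inE.
have LZ : (<[z]> \subset linear_perms)%g by rewrite cycle_subG.
have [d Ed le_dn] := card_submod (submod_afix LZ submodT).
have := pgroup_fix_mod z_rgroup acts_z; rewrite card_finvect Ed -/q expn_r.
case/esym/exp_r_cond => // E.
  have /cards1P[w Ew] : #|'Fix_([set: VV] | 'P)(<[z]>)|%g == 1%N by rewrite Ed E.
  have: v \in [set w] by rewrite -Ew inE inE mem_afix_cycle zv eqxx.
  have: 0 \in [set w] by rewrite -Ew inE inE mem_afix_cycle (lin0 zL) eqxx.
  by move=> /set1P -> /set1P.
have z1 : z = 1%g.
  apply/permP=> u; rewrite perm1; apply/eqP; rewrite -mem_afix_cycle.
  have : u \in [set: VV] by rewrite inE.
  suff /eqP <- : 'Fix_([set: VV] | 'P)(<[z]>)%g == [set: VV] by case/setIP.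
  by rewrite eqEcard subsetT card_finvect Ed E; apply: leqnn.
by have := r_pr; rewrite -oz z1 order1.
Qed.

(** Only 0 is fixed by [z] in [A], so [#|A| = q ^ d] is 1 modulo [r] and [d] is 0 or [n]; the vector
    [v] excludes 0. *)
Lemma zsigmondy_irr A v : GRing.submod_closed A -> {in A, forall u, z u \in A} ->
  v \in A -> v != 0 -> A = setT.
Proof.
move=> Amod zA vA v_neq0; have acts_z : [acts <[z]>, on A | 'P]%g.
  by rewrite cycle_subG !inE; apply/subsetP => u /zA; rewrite inE.
have [d Ed le_dn] := card_submod Amod.
have := pgroup_fix_mod z_rgroup acts_z.
have -> : 'Fix_(A | 'P)(<[z]>)%g = [set 0].
  apply/setP=> u; rewrite inE mem_afix_cycle inE.
  apply/andP/eqP=> [[_ /eqP/zsigmondy_fix] //|->]; case: Amod => A0 _.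
  by rewrite lin0.
rewrite cards1 Ed => /exp_r_cond[] // E.
  move: Ed; rewrite E => /eqP/cards1P[w Ew].
  case: Amod; rewrite Ew => /set1P Ew0 _; move: vA; rewrite Ew -Ew0 => /set1P v0.
  by rewrite v0 eqxx in v_neq0.
by apply/eqP; rewrite eqEcard subsetT card_finvect Ed E; apply: leqnn.
Qed.

(** The vectors fixed by [c] form a [z]-invariant subspace. *)
Lemma zsigmondy_cent_fix c v : c \in linear_perms -> commute z c -> c v = v ->
  v != 0 -> c = 1%g.
Proof.
move=> cL zc cv v0; have Lc : [set c] \subset linear_perms by rewrite sub1set.
have := zsigmondy_irr (submod_afix Lc submodT).
have inFix u : (u \in 'Fix_([set: VV] | 'P)([set c])%g) = (c u == u).
  by rewrite inE inE; apply/afix1P/eqP.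
move/(_ v) => H; apply/permP=> u; rewrite perm1; apply/eqP; rewrite -inFix.
rewrite H //; first by rewrite inE.
  by move=> w; rewrite !inFix -permM zc permM => /eqP ->.
by rewrite inFix cv.
Qed.

End ZsigmondyElement.

End LinearGroups.

(** * Fixed-point-free actions and orbit sums *)

Section SumTricks.

Variables (F : finFieldType) (V : vectType F).
Local Notation VV := (finvect_type V).
Implicit Types (A : {set VV}) (v u w : VV) (z c : {perm VV}).
Implicit Types (X B : {group {perm VV}}).

Definition fixfree c := forall v : VV, c v = v -> v = 0.

Lemma fixfree_conj z x : x \in linear_perms V -> fixfree z -> fixfree (z ^ x).
Proof.
move=> xL zf w; rewrite conjgE !permM => /(congr1 (x^-1)%g); rewrite permK => /zf.
by move/(congr1 x); rewrite permKV lin0.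
Qed.

(** Applying [c] permutes the summands cyclically, so the sum is a fixed vector. *)
Lemma orbit_sum_fixfree c k v : c \in linear_perms V -> (c ^+ k = 1)%g -> fixfree c ->
  \sum_(j < k) (c ^+ j)%g v = 0.
Proof.
move=> cL ck cf; apply: cf; rewrite lin_sum //.
case: k ck => [|k] ck; first by rewrite !big_ord0.
rewrite big_ord_recr big_ord_recl /= -permM -expgSr ck addrC; congr (_ + _).
by apply: eq_bigr => i _; rewrite -permM -expgSr.
Qed.

(* If [b] were not a power of [a], the sums over the orbits of the elements
   [b a^i] would all vanish; adding them up, and discarding the vanishing sums
   over the orbits of the [a^j], leaves [s v = 0]. *)
Lemma semiregular_prime_order X a b s : X \subset linear_perms V ->
    (forall c, c \in X -> c != 1%g -> fixfree c) ->
    a \in X -> b \in X -> commute a b -> prime s -> #[a]%g = s -> #[b]%g = s ->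
  s%:R != 0 :> F -> b \in <[a]>%g.
Proof.
move=> /subsetP XL Xf aX bX cab s_pr oa ob s0; apply/negPn/negP=> bNa.
suff a1 : a = 1%g by move: s_pr; rewrite -oa a1 order1.
apply/permP=> v; suff -> : v = 0 by rewrite perm1 lin0 ?XL.
have as1 : (a ^+ s = 1)%g by rewrite -oa expg_order.
have bs1 : (b ^+ s = 1)%g by rewrite -ob expg_order.
have ba_neq1 i : (b * a ^+ i)%g != 1%g.
  apply: contra bNa => /eqP E; have -> : b = (a ^- i)%g.
    by rewrite -[LHS](mulgK (a ^+ i)%g) E mul1g.
  by rewrite groupV mem_cycle.
have H i : \sum_(j < s) (b ^+ j * a ^+ j ^+ i)%g v = 0.
  rewrite -[RHS](@orbit_sum_fixfree (b * a ^+ i)%g s v).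
  - apply: eq_bigr => j _; rewrite expgMn; last exact/commuteX/commute_sym.
    by rewrite -!expgM mulnC.
  - by rewrite XL // groupM ?groupX.
  - rewrite expgMn; last exact/commuteX/commute_sym.
    by rewrite bs1 mul1g -expgM mulnC expgM as1 expg1n.
  - by apply: Xf; rewrite ?groupM ?groupX.
have : \sum_(i < s) \sum_(j < s) (b ^+ j * a ^+ j ^+ i)%g v = 0.
  by apply: big1 => i _; apply: H.
rewrite exchange_big /=.
have s_gt0 := prime_gt0 s_pr; rewrite (bigD1 (Ordinal s_gt0)) //= [X in _ + X]big1 ?addr0.
  rewrite (eq_bigr (fun=> v)) => [|i _]; last by rewrite !expg0 expg1n mulg1 perm1.
  rewrite sumr_const card_ord -scaler_nat => /eqP; rewrite scaler_eq0 (negPf s0).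
  by move/eqP.
move=> j; rewrite -val_eqE /= => j0.
rewrite (eq_bigr (fun i : 'I_s => (a ^+ j ^+ i)%g ((b ^+ j)%g v))) => [|i _]; last by rewrite permM.
apply: orbit_sum_fixfree; first by rewrite groupX ?XL.
  by rewrite -expgM mulnC expgM as1 expg1n.
apply: Xf; rewrite ?groupX // -order_dvdn oa gtnNdvd // lt0n //.
Qed.

(* [X <z>] is a Frobenius group. For each [x] in [X] the sum of [v] over the
   orbit of [z ^ x] vanishes; summing over [x], and using that
   [x |-> [~ x, z^-i]] permutes [X] for [i != 0], gives [#|X| v = \sum_x x v],
   which is fixed by [X]. *)
Lemma coprime_fixfree_kernel X z r : prime r -> #[z]%g = r ->
    X \subset linear_perms V -> z \in linear_perms V -> z \in 'N(X)%g ->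
    'C_X(<[z]>)%g = 1%g -> fixfree z -> #|X|%:R != 0 :> F ->
  X :=: 1%g.
Proof.
move=> r_pr oz /subsetP XL zL nXz CXz zf X0.
have zr : (z ^+ r = 1)%g by rewrite -oz expg_order.
apply/trivgP/subsetP=> y yX; rewrite inE; apply/eqP/permP=> v; rewrite perm1.
pose u := \sum_(x in X) (x : {perm VV}) v.
have : \sum_(x in X) \sum_(i < r) ((z ^+ i) ^ x)%g v = 0.
  apply: big1 => x xX; rewrite -[RHS](@orbit_sum_fixfree (z ^ x)%g r v).
  - by apply: eq_bigr => i _; rewrite conjXg.
  - by apply: groupJ => //; apply: XL.
  - by rewrite -conjXg zr conj1g.
  - exact: fixfree_conj (XL _ xX) zf.
rewrite exchange_big /=; have r_gt0 := prime_gt0 r_pr.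
rewrite (bigD1 (Ordinal r_gt0)) //=.
rewrite (eq_bigr (fun=> v)) => [|x _]; last by rewrite conj1g perm1.
rewrite sumr_const.
have E (i : 'I_r) : i != Ordinal r_gt0 -> \sum_(x in X) ((z ^+ i) ^ x)%g v = (z ^+ i)%g u.
  rewrite -val_eqE /= => i0.
  have iX : (z ^- i)%g \in 'N(X)%g by rewrite groupV groupX.
  pose f x := [~ x, (z ^- i)%g]%g.
  (* If [f x = f x'], then [x' * x^-1] commutes with [z ^- i], which generates [<[z]>], so it lies
     in the trivial group ['C_X(<[z]>)]. *)
  have f_inj : {in X &, injective f}.
    move=> x x' xX x'X; rewrite /f !commgEl => /(congr1 (mulg x')) E.
    have cent : (x' * x^-1)%g \in 'C_X(<[z]>)%g.
      rewrite inE groupM ?groupV //= cent_cycle.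
      suff : (x' * x^-1)%g \in 'C[z ^- i]%g.
        rewrite -!cent_cycle; apply: subsetP; rewrite centS // cycleV.
        have co : coprime i #[z]%g.
          by rewrite oz coprime_sym prime_coprime // gtnNdvd // lt0n.
        have /eqP -> : generator <[z]>%g (z ^+ i)%g by rewrite generator_coprime coprime_sym.
        exact: subxx.
      apply/cent1P/commgP/conjg_fixP; rewrite conjMg conjVg.
      by apply: (mulIg (x ^ (z ^- i))%g); rewrite mulgKV -mulgA E mulKVg.
    by move: cent; rewrite CXz => /set1gP/(canRL (mulgKV _)); rewrite mul1g.
  have fX : f @: X = X.
    apply/eqP; rewrite eqEcard card_in_imset // leqnn andbT.
    apply/subsetP=> _ /imsetP[x xX ->]; rewrite /f commgEl groupM ?groupV //.
    by rewrite memJ_norm.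
  transitivity ((z ^+ i)%g (\sum_(x in f @: X) (x : {perm VV}) v)); last by rewrite fX.
  rewrite big_imset //= lin_sum ?groupX //.
  apply: eq_bigr => x xX; rewrite -permM /f commgEl; congr (fun_of_perm _ v).
  by rewrite !conjgE invgK !mulgA mulgKV.
rewrite (eq_bigr (fun i : 'I_r => (z ^+ i)%g u)) //.
(* The orbit sum of [u] under [z] vanishes as well, so the terms with [i != 0] add up to [- u]. *)
have := orbit_sum_fixfree u zL zr zf; rewrite (bigD1 (Ordinal r_gt0)) //= perm1.
move=> /eqP; rewrite addrC addr_eq0 => /eqP -> /eqP; rewrite subr_eq0 => /eqP Eu.
have : y (#|X|%:R *: v) = #|X|%:R *: v.
  rewrite scaler_nat Eu lin_sum ?XL // [RHS](reindex_inj (mulIg y)).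
  by apply: eq_big => [x|x _]; rewrite ?groupMr // permM.
by rewrite linZ ?XL // => /(scalerI X0).
Qed.

(** In a coprime action on an abelian group, [<[z]>] has no nontrivial fixed point in [[~: X,
    <[z]>]], so [coprime_fixfree_kernel] makes this commutator trivial. *)
Lemma abelian_cent_fixfree X z r : prime r -> #[z]%g = r ->
    X \subset linear_perms V -> z \in linear_perms V -> z \in 'N(X)%g ->
    fixfree z -> #|X|%:R != 0 :> F -> coprime #|X| r -> abelian X ->
  X \subset 'C(<[z]>)%g.
Proof.
move=> r_pr oz XL zL nXz zf X0 co abX.
have nXZ : (<[z]> \subset 'N(X))%g by rewrite cycle_subG.
have sCX : ([~: X, <[z]>] \subset X)%g by rewrite commg_subl.
apply/commG1P; apply: (coprime_fixfree_kernel r_pr oz) => //=.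
- exact: subset_trans XL.
- by rewrite -cycle_subG commg_normr.
- by apply: coprime_abel_cent_TI => //; rewrite -orderE oz.
- apply: contraNneq X0 => E; rewrite -(LagrangeI X [~: X, <[z]>]%g) (setIidPr sCX).
  by rewrite natrM E mul0r.
Qed.

End SumTricks.

(** * Groups centralised or normalised by a Zsigmondy element *)

Section ZsigmondyCentraliser.

Variables (F : finFieldType) (V : vectType F).
Local Notation VV := (finvect_type V).
Variables (r : nat) (z : {perm VV}).
Hypotheses (zL : z \in linear_perms V) (oz : #[z]%g = r).
Hypothesis rP : zsigmondy_prime #|F| (\dim {:V}) r.

(* For [v != 0] the vectors [g v], [g \in <[z]>], span the space, so [c v] and
   [d v] are both combinations of them. *)
Lemma zsigmondy_cent_commute c d : c \in linear_perms V -> d \in linear_perms V ->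
  commute z c -> commute z d -> commute c d.
Proof.
move=> cL dL zc zd; apply/permP=> v.
have [->|v0] := eqVneq v 0; first by rewrite !permM !lin0 // lin0.
pose comb (a : {ffun {perm VV} -> F}) : VV := \sum_(g in <[z]>%g) a g *: (g : {perm VV}) v.
pose A := [set comb a | a in [set: {ffun {perm VV} -> F}]].
have gL g : g \in <[z]>%g -> g \in linear_perms V.
  by apply: subsetP; rewrite cycle_subG.
have Amod : GRing.submod_closed A.
  split.
    apply/imsetP; exists [ffun=> 0] => //.
    by rewrite /comb big1 // => g _; rewrite ffunE scale0r.
  move=> k _ _ /imsetP[a _ ->] /imsetP[b _ ->]; apply/imsetP.
  exists [ffun g => k * a g + b g] => //; rewrite /comb scaler_sumr -big_split /=.
  by apply: eq_bigr => g _; rewrite ffunE scalerDl scalerA.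
have AT : A = setT.
  apply: (zsigmondy_irr zL oz rP Amod _ _ v0).
    move=> _ /imsetP[a _ ->]; apply/imsetP; exists [ffun g => a (g * z^-1)%g] => //.
    rewrite /comb [RHS](reindex_inj (mulIg z)) lin_sum //.
    apply: eq_big => [g|g gz]; first by rewrite groupMr ?cycle_id.
    by rewrite ffunE mulgK permM linZ.
  apply/imsetP; exists [ffun g => (g == 1%g)%:R] => //.
  rewrite /comb (bigD1 1%g) ?group1 //= ffunE eqxx scale1r perm1 big1 ?addr0 // => g.
  by case/andP=> _ /negPf g1; rewrite ffunE g1 scale0r.
have all_comb w : exists a, w = comb a.
  have: w \in A by rewrite AT inE.
  by case/imsetP=> a _ ->; exists a.
have comm_pt e g w : commute z e -> g \in <[z]>%g -> e (g w) = g (e w).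
  move=> ze /cycleP[i ->]; rewrite -!permM; congr (fun_of_perm _ w).
  exact/commute_sym/commuteX.
have [a Ea] := all_comb (c v); have [b Eb] := all_comb (d v).
rewrite !permM {1}Ea Eb /comb !lin_sum //.
transitivity (\sum_(g in <[z]>%g) \sum_(h in <[z]>%g)
    a g *: (b h *: (g : {perm VV}) ((h : {perm VV}) v))).
  apply: eq_bigr => g gz; rewrite linZ // comm_pt // Eb /comb lin_sum ?gL // scaler_sumr.
  by apply: eq_bigr => h hz; rewrite linZ ?gL.
rewrite exchange_big; apply: eq_bigr => h hz.
rewrite linZ // comm_pt // Ea /comb lin_sum ?gL // scaler_sumr.
apply: eq_bigr => g gz; rewrite linZ ?gL // !scalerA mulrC -!permM; congr (_ *: fun_of_perm _ v).
by have /centsP := cycle_abelian z; apply.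
Qed.

(** A [p]-group in characteristic [p] fixes a nonzero vector. As [z] normalises [T], the fixed
    vectors of [T] form a [z]-invariant subspace, hence the whole space. *)
Lemma zsigmondy_norm_pgroup p (T : {group {perm VV}}) : prime p -> (p %| #|F|)%N ->
  (0 < \dim {:V})%N -> T \subset linear_perms V -> (p.-group T)%g -> z \in 'N(T)%g -> T :=: 1%g.
Proof.
move=> p_pr pF n_gt0 TL pT nTz.
have := submod_afix TL (submodT V); set A := (_ :&: _) => Amod.
have inA u : reflect (forall t, t \in T -> t u = u) (u \in A).
  by rewrite inE inE; apply: (iffP afixP).
have acts_T : [acts T, on [set: VV] | 'P]%g by apply/actsP=> s _ u; rewrite !inE.
have := pgroup_fix_mod pT acts_T; rewrite card_finvect => Ep.
have pA : (p %| #|A|)%N.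
  by rewrite /dvdn -Ep -/(dvdn _ _) (dvdn_trans pF) // -{1}[#|F|]expn1 dvdn_exp2l.
have [v vA v0] : exists2 v, v \in A & v != 0.
  apply: submod_neq0 => //; apply: leq_trans (prime_gt1 p_pr) (dvdn_leq _ pA).
  by rewrite (cardD1 0); case: Amod => ->.
have AT : A = setT.
  apply: (zsigmondy_irr zL oz rP Amod _ vA v0) => u /inA uT; apply/inA => t tT.
  rewrite -permM (conjgCV z t) permM uT // memJ_norm ?groupV //.
apply/trivgP/subsetP=> t tT; rewrite inE; apply/eqP/permP=> u; rewrite perm1.
have /inA uT : u \in A by rewrite AT inE.
exact: uT.
Qed.

End ZsigmondyCentraliser.

(** * Linear relations between group elements acting on a subspace *)

Section LinearRelations.

Variables (F : finFieldType) (V : vectType F).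
Local Notation VV := (finvect_type V).
Variables (A : {set VV}).
Hypothesis Amod : GRing.submod_closed A.
Implicit Types (v u w : VV) (B Z : {group {perm VV}}).

(** Pigeonhole: there are [#|F| ^ #|X|] coefficient functions supported on [X], but at most
    [#|F| ^ (d * d)] outcomes on a basis of [A]. The difference of two functions with the same
    outcome is a relation. *)
Lemma relation_of_card (X : {set {perm VV}}) d : X \subset linear_perms V ->
    (forall x v, x \in X -> v \in A -> x v \in A) ->
    (#|A| = #|F| ^ d)%N -> (d * d < #|X|)%N ->
  exists2 a : {perm VV} -> F, exists2 x0, x0 \in X & a x0 != 0
    & (forall x, x \notin X -> a x = 0) /\
      (forall v, v \in A -> \sum_(x in X) a x *: x v = 0).
Proof.
move=> /subsetP XL XA Ad ltdX; have [W defA] := submod_vspace Amod.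
have q_gt1 := card_finNzRing_gt1 F.
have dimW : \dim W = d.
  apply: (expnI q_gt1); by rewrite -Ad (eq_card defA) card_vspace.
pose b := vbasis W.
have bA i : (i < d)%N -> b`_i \in A.
  by move=> ltid; rewrite defA vbasis_mem // mem_nth // size_tuple dimW.
pose Phi (a : {ffun {perm VV} -> F}) : {ffun 'I_d -> VV} :=
  [ffun i : 'I_d => \sum_(x in X) a x *: (x : {perm VV}) b`_i].
have [/dinjectiveP injPhi|] := boolP (dinjectiveb Phi (pffun_on 0 X predT)).
  have: (#|pffun_on (0%R : F) X (@predT F)| <= #|A| ^ d)%N.
    rewrite -[d in (_ ^ d)%N]card_ord -(card_ffun_on 'I_d A) -(card_in_imset injPhi).
    apply/subset_leq_card/subsetP=> _ /imsetP[a _ ->].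
    apply/ffun_onP=> i; rewrite ffunE; apply: submod_sum => // x xX.
    by case: (Amod) => A0 AL; rewrite -[_ *: _]addr0 AL // XA // bA.
  rewrite card_pffun_on Ad -expnM leq_exp2l //.
  by rewrite leqNgt ltdX.
case/dinjectivePn=> a aX [a' /andP[/= ne a'X] E].
pose c x := a x - a' x.
have csupp x : x \notin X -> c x = 0.
  move=> xX; rewrite /c; case/pffun_onP: aX => /subsetP aX _.
  case/pffun_onP: a'X => /subsetP a'X _.
  by rewrite (contraNeq (aX x) xX) (contraNeq (a'X x) xX) subrr.
exists c.
  have [x cx] : exists x, c x != 0.
    apply/existsP; apply: contraNT ne => /existsPn c0; apply/eqP/ffunP=> x.
    by apply/eqP; have := c0 x; rewrite negbK /c subr_eq0 eq_sym.
  by exists x => //; apply: contraNT cx => /csupp ->.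
split=> // v vA.
have cb (i : 'I_(\dim W)) : \sum_(x in X) c x *: (x : {perm VV}) b`_i = 0.
  have ltid : (i < d)%N by rewrite -dimW.
  have /ffunP/(_ (Ordinal ltid)) := E; rewrite !ffunE /= => /eqP.
  rewrite -subr_eq0 -sumrB => /eqP E0; rewrite -[RHS]E0.
  by apply: eq_bigr => x _; rewrite scalerBl.
have vW : v \in W by rewrite -defA.
rewrite (coord_vbasis vW).
rewrite (eq_bigr (fun x : {perm VV} => \sum_(i < \dim W) coord b i v *: (c x *: x b`_i))).
  rewrite exchange_big big1 // => i _.
  by rewrite -scaler_sumr cb scaler0.
move=> x xX; rewrite lin_sum ?XL // scaler_sumr; apply: eq_bigr => i _.
by rewrite linZ ?XL // !scalerA mulrC.
Qed.

Section Averaging.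

Variable B : {group {perm VV}}.
Hypotheses (BL : B \subset linear_perms V) (B0 : #|B|%:R != 0 :> F).
Hypothesis BA : forall g v, g \in B -> v \in A -> g v \in A.
Hypothesis Bcomm : forall x, x \in B -> x \notin 'Z(B)%g ->
  exists2 g, g \in B & [~ x, g]%g \in 'Z(B)%g
                       /\ forall v, v \in A -> [~ x, g]%g v = v -> v = 0.

(* Average the relation over its conjugates: for noncentral [x], the sum of the
   conjugates of [x] is fixed by the commutator [[~ x, g]], hence vanishes. *)
Lemma relation_center_part (a : {perm VV} -> F) :
    (forall v, v \in A -> \sum_(x in B) a x *: (x : {perm VV}) v = 0) ->
  forall v, v \in A -> \sum_(x in 'Z(B)%g) a x *: (x : {perm VV}) v = 0.
Proof.
move=> rel v vA; have BLin g : g \in B -> g \in linear_perms V := subsetP BL g.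
have conjE (g x : {perm VV}) w : (x ^ g)%g w = g (x ((g^-1)%g w)).
  by rewrite conjgE !permM.
have : \sum_(g in B) \sum_(x in B) a x *: ((x ^ g)%g : {perm VV}) v = 0.
  apply: big1 => g gB; rewrite -[RHS](lin0 (BLin g gB)) -[in RHS](rel (g^-1%g v)).
    rewrite lin_sum ?BLin //; apply: eq_bigr => x xB.
    by rewrite linZ ?BLin // conjE.
  by rewrite BA ?groupV.
rewrite exchange_big /= (bigID (mem 'Z(B)%g)) /= [X in _ + X]big1 ?addr0; last first.
  move=> x /andP[xB xNZ]; rewrite -scaler_sumr.
  have [g gB [xgZ fixA]] := Bcomm xB xNZ.
  suff -> : \sum_(i in B) (x ^ i)%g v = 0 by rewrite scaler0.
  apply: fixA.
    by apply: submod_sum => // h hB; rewrite BA ?groupJ.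
  have gxB : [~ x, g]%g \in B by case/centerP: xgZ.
  rewrite lin_sum ?BLin // [RHS](reindex_inj (mulgI g)).
  apply: eq_big => [h|h hB]; first by rewrite groupMl.
  rewrite -permM conjgM (conjg_mulR x g) conjMg.
  case/centerP: xgZ => _ /(_ h hB) cxgh.
  by rewrite (_ : ([~ x, g] ^ h)%g = [~ x, g]%g) //; apply/conjg_fixP/commgP.
move=> E; apply: (scalerI B0); rewrite scaler0 -[RHS]E scaler_sumr.
rewrite [RHS](eq_bigl (mem 'Z(B)%g)) => [|x]; last first.
  by rewrite andb_idl // => /centerP[].
apply: eq_bigr => x /centerP[xB cxB]; rewrite -scaler_sumr scalerA mulrC -scalerA.
congr (_ *: _); rewrite (eq_bigr (fun=> x v)); last first.
  by move=> g gB; congr (fun_of_perm _ v); apply/conjg_fixP/commgP/cxB.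
by rewrite sumr_const scaler_nat.
Qed.

(** A relation on a transversal [X] of [Z] in [B] is translated by the inverse of some [x0] in its
    support, which puts a nonzero coefficient at 1. The support still meets each coset of [Z] at
    most once, and [relation_center_part] discards the terms outside ['Z(B)]. *)
Lemma relation_on_center Z d : Z \subset B -> (#|A| = #|F| ^ d)%N ->
    (d * d < #|B : Z|%g)%N ->
  exists2 c : {perm VV} -> F, c 1%g != 0
    & [/\ forall b b', b \in B -> b' \in B -> c b != 0 -> c b' != 0 ->
            (b * b'^-1)%g \in Z -> b = b'
        & forall v, v \in A -> \sum_(x in 'Z(B)%g) c x *: (x : {perm VV}) v = 0].
Proof.
move=> sZB Ad ltd; pose X := [set repr C | C in rcosets Z B].
have reprB C : C \in rcosets Z B -> repr C \in B /\ C = (Z :* repr C)%g.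
  case/rcosetsP=> x xB ->; rewrite rcoset_repr; split=> //.
  apply: subsetP (mem_repr_rcoset _ _); apply/subsetP=> _ /rcosetP[y yZ ->].
  by rewrite groupM // (subsetP sZB).
have XB : X \subset B by apply/subsetP=> _ /imsetP[C /reprB[CB _] ->].
have X_inj x y : x \in X -> y \in X -> (x * y^-1)%g \in Z -> x = y.
  move=> /imsetP[C /reprB[_ EC] ->] /imsetP[D /reprB[_ ED] ->] h.
  by congr repr; rewrite EC ED; apply/rcoset_eqP; rewrite mem_rcoset.
have oX : #|X| = #|B : Z|%g.
  by rewrite card_in_imset // => C D /reprB[_ EC] /reprB[_ ED] E; rewrite EC ED E.
have XA x v : x \in X -> v \in A -> x v \in A by move=> xX; apply/BA/(subsetP XB).
rewrite -oX in ltd.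
have [a [x0 x0X ax0] [asupp arel]] := relation_of_card (subset_trans XB BL) XA Ad ltd.
have x0B := subsetP XB x0 x0X.
exists (fun b => a (b * x0)%g); first by rewrite mul1g.
split.
  move=> b b' bB b'B cb cb' h; apply: (mulIg x0).
  apply: X_inj; first by apply: contraNT cb => /asupp ->.
    by apply: contraNT cb' => /asupp ->.
  by rewrite invMg mulgA mulgK.
apply: relation_center_part => v vA.
have x0L : (x0^-1)%g \in linear_perms V by rewrite groupV (subsetP BL).
rewrite -[RHS](lin0 x0L) -[in RHS](arel v vA) lin_sum // (reindex_inj (mulIg (x0^-1)%g)) /=.
rewrite (eq_bigl (mem B)) => [|x]; last by rewrite groupMr ?groupV.
rewrite (big_setID X) /= (setIidPr XB) [X in _ + X]big1 ?addr0 => [|x]; last first.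
  by case/setDP=> _ /asupp ax; rewrite mulgKV ax scale0r.
by apply: eq_bigr => x _; rewrite linZ // mulgKV permM.
Qed.

End Averaging.

End LinearRelations.

Local Close Scope ring_scope.

(** * Coprime action, Fitting subgroups and extraspecial groups *)

Section SolvableGroups.

Import GroupScope.
Variable gT : finGroupType.
Implicit Types G H P A : {group gT}.

(** Coprime action gives [G = [~: G, A] * 'C_G(A)], and the second factor adds nothing to the
    commutator with [A]. *)
Lemma coprime_commGid A G : A \subset 'N(G) -> coprime #|G| #|A| -> solvable G ->
  [~: G, A, A] = [~: G, A].
Proof.
move=> nGA coGA solG; apply/eqP; rewrite eqEsubset commSg ?commg_subl //=.
have sRG : [~: G, A] \subset G by rewrite commg_subl.
have nRG : G \subset 'N([~: G, A]) := commg_norml _ _.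
have defG : [~: G, A] * 'C_G(A) = G.
  apply/eqP; rewrite eqEsubset mul_subG ?subsetIl //= -quotientSK //.
  rewrite coprime_quotient_cent ?commg_normr //.
  by rewrite subsetI subxx quotient_cents2r.
rewrite -{1}defG commMG; last first.
  apply: normsR; first exact: subset_trans (subsetIl _ _) nRG.
  by rewrite cents_norm // subsetIr.
by rewrite (commG1P (subsetIr G 'C(A))) mulg1.
Qed.

(** Otherwise take the last term of the derived series of ['C_G('F(G))] not inside ['F(G)]. Its
    derived subgroup lies in ['F(G)], which it centralises, so it is nilpotent; being normal in [G],
    it lies in ['F(G)]. *)
Lemma cent_sub_Fitting G : solvable G -> 'C_G('F(G)) \subset 'F(G).
Proof.
move=> solG; apply/negPn/negP=> nsCF.
have nCG : 'C_G('F(G)) <| G.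
  by have := subcent_normal G 'F(G); rewrite (setIidPl (normal_norm (Fitting_normal G))).
have /derivedP solC := solvableS (normal_sub nCG) solG.
have ex : exists n, ('C_G('F(G)))^`(n) \subset 'F(G).
  by case: solC => // n E; exists n; rewrite E sub1G.
case: (ex_minnP ex) => [[|k] sub_k min_k]; first by rewrite derg0 in sub_k; rewrite sub_k in nsCF.
have : k.+1 <= k; last by rewrite ltnn.
apply: min_k; apply: Fitting_max.
  by apply: char_normal_trans nCG; apply: der_char.
rewrite -quotient_center_nil; apply: abelian_nil.
rewrite sub_der1_abelian // subsetI der_sub /= derg1 -dergSn.
by apply: subset_trans sub_k _; rewrite centsC (subset_trans (der_sub _ _)) // subsetIr.
Qed.

(** [x] cannot centralise ['F(G)], which is generated by the ['O_s(G)]. *)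
Lemma not_Fitting_pcore G x : solvable G -> x \in G -> x \notin 'F(G) ->
  exists2 s, prime s & x \notin 'C('O_s(G)).
Proof.
move=> solG xG xNF; have: ~~ ('F(G) \subset 'C[x]).
  apply: contra xNF; rewrite sub_cent1 => cx.
  by apply: subsetP (cent_sub_Fitting solG) _ _; rewrite inE xG.
rewrite FittingEgen gen_subG => cN.
have /exists_inP[s] : [exists (s : 'I_#|G|.+1 | (s : nat) \in \pi(G)), ~~ ('O_s(G) \subset 'C[x])].
  apply: contraR cN; rewrite negb_exists_in => /forall_inP H.
  by apply/bigcupsP=> s /H; rewrite negbK.
by rewrite mem_primes sub_cent1 => /andP[s_pr _]; exists s.
Qed.

Lemma mem_Fitting_pcore G (r : nat) x : x \in 'F(G) -> r.-elt x -> x \in 'O_r(G).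
Proof.
move=> xF rx; rewrite -p_core_Fitting.
by rewrite (mem_Hall_pcore (nilpotent_pcore_Hall _ (Fitting_nil G))).
Qed.

Lemma extraspecial_commg G H x : extraspecial G -> H \subset G -> x \in H -> x \notin 'Z(H) ->
  exists2 g, g \in H & [~ x, g] \in 'Z(G) /\ [~ x, g] != 1.
Proof.
move=> exG sHG xH xNZ; have [g gH ng] : exists2 g, g \in H & [~ x, g] != 1.
  apply/exists_inP; apply: contraR xNZ; rewrite negb_exists_in => /forall_inP H1.
  by apply/centerP; split=> // g gE; apply/commgP; have := H1 g gE; rewrite negbK.
exists g => //; split=> //; have [[_ <-] _] := exG.
by rewrite mem_commg // (subsetP sHG).
Qed.

End SolvableGroups.

(** By Fermat [r] divides [q ^ r.-1 - 1], so [r.-1 < n] is impossible. *)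
Lemma zsigmondy_gt q n r : 1 < q -> 0 < n -> zsigmondy_prime q n r -> n < r.
Proof.
move=> q_gt1 n_gt0 [r_pr rn rmin]; have q_gt0 := ltnW q_gt1.
rewrite -[r](prednK (prime_gt0 r_pr)) ltnS leqNgt; apply/negP=> lt_rn.
have := rmin r.-1; rewrite lt_rn andbT -ltnS (prednK (prime_gt0 r_pr)) prime_gt1 //.
rewrite dvdn_exp_sub1 // -totient_prime // => /(_ isT)/eqP[].
exact/Euler_exp_totient/(coprime_of_dvd_exp_sub1 q_gt0 n_gt0 r_pr rn).
Qed.

Local Open Scope ring_scope.

(** * The case of [z] in ['O_r(G)], and the action of [z] on an [s]-group [T] *)

Section ZsigmondyGroups.

Import GroupScope.
Variables (F : finFieldType) (V : vectType F).
Local Notation VV := (finvect_type V).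
Local Notation L := (linear_perms V).
Local Notation n := (\dim {:V}).
Variables (r : nat) (z : {perm VV}).
Hypotheses (zL : z \in L) (oz : #[z] = r).
Hypothesis rP : zsigmondy_prime #|F| n r.
Hypothesis n_gt1 : (1 < n)%N.
Implicit Types (G P T E : {group {perm VV}}).

Let r_pr : prime r. Proof. by case: rP. Qed.
Let n_gt0 : (0 < n)%N := ltnW n_gt1.
Let q_gt1 : (1 < #|F|)%N := card_finNzRing_gt1 F.
Let n_lt_r : (n < r)%N := zsigmondy_gt q_gt1 n_gt0 rP.
Let z_fixfree : fixfree z := zsigmondy_fix zL oz rP.

Lemma cent_zsigmondy_fixfree c : c \in L -> commute z c -> c != 1 -> fixfree c.
Proof.
move=> cL zc c1 v cv; apply/eqP; apply: contraNT c1 => v0.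
by apply/eqP; apply: zsigmondy_cent_fix zL oz rP _ _ cL zc cv v0.
Qed.

Lemma pgroup_natr_neq0 (s : nat) G : s.-group G -> prime s -> s%:R != 0 :> F -> #|G|%:R != 0 :> F.
Proof. by move=> sG s_pr s0; rewrite (card_pgroup sG) natrX expf_neq0. Qed.

(** A conjugate of [z] lies in [P], has order [r] and commutes with [z], hence is a power of [z] by
    [semiregular_prime_order]. So ['C_G(<[z]>)] is normal; it is abelian and contains [P], which is
    therefore characteristic in it. *)
Lemma Sylow_normal_of_pcore G P : G \subset L -> r.-Sylow(G) P -> z \in 'Z(P) ->
  z \in 'O_r(G) -> r%:R != 0 :> F -> P <| G.
Proof.
move=> GL sylP /centerP[zP zcP] zO r0.
have sPG := pHall_sub sylP; have PL := subset_trans sPG GL.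
have zG := subsetP sPG z zP.
have nzG : G \subset 'N(<[z]>).
  apply/subsetP=> g gG; rewrite inE -cycleJ cycle_subG.
  have zgP : z ^ g \in P.
    apply: (subsetP (pcore_sub_Hall sylP)); rewrite memJ_norm //.
    exact: subsetP (gFnorm _ _) _ gG.
  apply: (semiregular_prime_order PL) r0 => //; last by rewrite orderJ.
    move=> c cP; apply: cent_zsigmondy_fixfree (subsetP PL _ cP) _.
    exact: zcP.
  exact: zcP.
have nCG : 'C_G(<[z]>) <| G.
  by have := subcent_normal G <[z]>; rewrite (setIidPl nzG).
have abC : abelian 'C_G(<[z]>).
  apply/centsP=> c /setIP[cG]; rewrite cent_cycle => /cent1P zc d /setIP[dG /cent1P zd].
  by apply: zsigmondy_cent_commute zL oz rP _ _ _ _ _ _ => //; rewrite (subsetP GL).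
have sPC : P \subset 'C_G(<[z]>).
  rewrite subsetI sPG centsC cycle_subG; apply/centP=> c cP; exact: zcP.
have sylPC := pHall_subl sPC (subsetIl _ _) sylP.
by rewrite (nilpotent_Hall_pcore (abelian_nil abC) sylPC) gFnormal_trans.
Qed.

Section ExtraspecialCommutator.

Variables (s : nat) (T : {group {perm VV}}).
Hypotheses (s_pr : prime s) (sr : s != r) (s0 : s%:R != 0 :> F).
Hypotheses (sT : s.-group T) (TL : T \subset L) (nTz : z \in 'N(T)) (ncTz : z \notin 'C(T)).

Let E := [~: T, <[z]>]%G.
Let sET : E \subset T. Proof. by rewrite commg_subl cycle_subG. Qed.
Let EL : E \subset L := subset_trans sET TL.
Let sE : s.-group E := pgroupS sET sT.
Let nEz : z \in 'N(E). Proof. by rewrite -cycle_subG commg_normr. Qed.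
Let co_sr : coprime s r.
Proof. by rewrite prime_coprime // dvdn_prime2. Qed.
Let co_group (H : {group {perm VV}}) : s.-group H -> coprime #|H| r.
Proof. by move=> sH; rewrite (card_pgroup sH) coprimeXl. Qed.
Let E_neq1 : E :!=: 1.
Proof.
by apply: contra ncTz => /eqP/commG1P; rewrite centsC cycle_subG.
Qed.

(** [z] centralises every abelian characteristic subgroup of [E] by [abelian_cent_fixfree], and [[~:
    E, <[z]>] = E], as [abelian_charsimple_special] requires. *)
Lemma commutator_special : special E /\ 'C_E(<[z]>) = 'Z(E).
Proof.
apply: (abelian_charsimple_special sE).
- by rewrite -orderE oz co_group.
- apply: coprime_commGid; rewrite ?cycle_subG // -?orderE ?oz ?co_group //.
  exact: pgroup_sol sT.
apply/bigcupsP=> H /andP[chH abH]; have sHE := char_sub chH.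
have sH := pgroupS sHE sE.
apply: (abelian_cent_fixfree r_pr oz) => //.
- exact: subset_trans EL.
- by apply: (subsetP (char_norm_trans chH (subxx _))).
- exact: pgroup_natr_neq0 sH s_pr s0.
- exact: co_group.
Qed.

Lemma commutator_center_fixfree x : x \in 'Z(E) -> x != 1 -> fixfree x.
Proof.
case: commutator_special => _ <- /setIP[xE]; rewrite cent_cycle => /cent1P xz.
exact: cent_zsigmondy_fixfree (subsetP EL x xE) (commute_sym xz).
Qed.

(** ['Z(E)] is elementary abelian with fixed-point-free nonidentity elements, so
    [semiregular_prime_order] makes it cyclic. *)
Lemma commutator_extraspecial : extraspecial E.
Proof.
have [spE _] := commutator_special; split=> //.
have Z_neq1 : 'Z(E) != 1 by rewrite center_nil_eq1 // (pgroup_nil sE).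
have abelZ := center_special_abelem sE spE.
have ZL : 'Z(E) \subset L := subset_trans (center_sub _) EL.
have [a aZ a1] := trivgPn _ Z_neq1.
have oZ b : b \in 'Z(E) -> b != 1 -> #[b] = s.
  by move=> bZ b1; apply: abelem_order_p abelZ bZ b1.
suff -> : 'Z(E) = <[a]> by rewrite -orderE oZ.
apply/eqP; rewrite eq_sym eqEsubset cycle_subG aZ /=; apply/subsetP=> b bZ.
have [-> | b1] := eqVneq b 1; first exact: group1.
apply: (semiregular_prime_order ZL) s0 => //; rewrite ?oZ //.
  exact: commutator_center_fixfree.
by have [_ _ ] := (abelemP s_pr abelZ); case: (abelemP s_pr abelZ) => /centsP cZ _; apply: cZ.
Qed.

(* With [#|E| = s ^ (2k+1)], counting the orbits of [z] on [E] gives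
   [r <= s^k + 1], independence of the cosets of ['Z(E)] as operators gives
   [s^k <= n], and [n < r] forces equality. *)
Lemma commutator_index : s = 2%N /\ (#|E : 'Z(E)| = n ^ 2)%N.
Proof.
have exE := commutator_extraspecial; have [_ CZ] := commutator_special.
have [k k_gt0 oE] := card_extraspecial sE exE.
have oZ : #|'Z(E)| = s := card_center_extraspecial sE exE.
have indE : (#|E : 'Z(E)| = (s ^ k) ^ 2)%N.
  have := Lagrange (center_sub E); rewrite oZ oE expnS => /eqP.
  by rewrite eqn_pmul2l ?prime_gt0 // -expnM -muln2 => /eqP.
have sk_gt1 : (1 < s ^ k)%N by rewrite -(expn0 s) ltn_exp2l // prime_gt1.
have r_le : (r <= (s ^ k).+1)%N.
  have rgz : r.-group <[z]> by rewrite /pgroup -orderE oz pnat_id.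
  have actz : [acts <[z]>, on E | 'J] by rewrite astabsJ cycle_subG.
  (* The fixed points of [z] on [E] form ['Z(E)], so [r] divides [s ^ (2k+1) - s], hence [s ^ k - 1]
     or [s ^ k + 1]. *)
  have := pgroup_fix_mod rgz actz; rewrite afixJ CZ oZ oE => /eqP.
  rewrite eqn_mod_dvd; last by rewrite -{1}(expn1 s) leq_exp2l // prime_gt1.
  rewrite expnS -[X in (_ - X)%N]muln1 -mulnBr Gauss_dvdr 1?coprime_sym //.
  rewrite -muln2 expnM -[X in (_ - X)%N](exp1n 2) subn_sqr Euclid_dvdM //.
  case/orP=> /dvdn_leq.
    by rewrite subn_gt0 => /(_ sk_gt1)/leq_trans; apply; apply: leq_trans (leq_subr _ _) (leqnSn _).
  by rewrite addn1 => /(_ isT).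
have sk_le : (s ^ k <= n)%N.
  rewrite leqNgt; apply/negP=> n_lt.
  have ltd : (n * n < #|E : 'Z(E)|)%N by rewrite indE -mulnn ltn_mul.
  have EV (g : {perm VV}) (v : VV) : g \in E -> v \in [set: VV] -> g v \in [set: VV].
    by rewrite inE.
  have comm x : x \in E -> x \notin 'Z(E) -> exists2 g, g \in E &
      [~ x, g] \in 'Z(E) /\ forall v, v \in [set: VV] -> [~ x, g] v = v -> v = 0.
    move=> xE xNZ; have [g gE [xgZ xg1]] := extraspecial_commg exE (subxx E) xE xNZ.
    by exists g => //; split=> // v _; apply: commutator_center_fixfree.
  have E0 := pgroup_natr_neq0 sE s_pr s0.
  have [c c1 [cinj crel]] := relation_on_center (submodT V) EL E0 EV comm (center_sub E) (card_finvect V) ltd.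
  (* [c] has at most one nonzero value on ['Z(E)], at 1, so the relation reads [c 1 *: v = 0]. *)
  have V0 (v : VV) : v = 0.
    have := crel v; rewrite inE => /(_ isT).
    rewrite (bigD1 1) ?group1 //= perm1 big1 ?addr0 => [|x /andP[xZ x1]].
      by move/eqP; rewrite scaler_eq0 (negPf c1) => /eqP.
    have [->|cx] := eqVneq (c x) 0; first by rewrite scale0r.
    case/eqP: x1; apply: cinj => //; first by case/centerP: xZ.
    by rewrite invg1 mulg1.
  have := card_finvect V; have -> : [set: VV] = [set 0].
    by apply/setP=> v; rewrite !inE (V0 v) eqxx.
  rewrite cards1 => /esym/eqP; rewrite -{1}(expn0 #|F|) eqn_exp2l //.
  by rewrite gtn_eqF.
have Er : r = (s ^ k).+1.
  by apply/eqP; rewrite eqn_leq r_le (leq_ltn_trans sk_le n_lt_r).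
have En : n = (s ^ k)%N.
  by apply/eqP; rewrite eqn_leq sk_le andbT -ltnS -Er.
split; last by rewrite indE En.
(* [r > n > 1] excludes [r = 2], so [s ^ k = r - 1] is even. *)
have [r2|r_odd] := even_prime r_pr; first by move: n_lt_r n_gt1; rewrite r2; case: n => [|[]].
move: r_odd; rewrite Er /= oddX negb_or => /andP[_].
by case: (even_prime s_pr) => // ->.
Qed.

End ExtraspecialCommutator.

End ZsigmondyGroups.

Local Close Scope ring_scope.

(** * Orbits of a normal subgroup of a transitive group *)

Section TransitiveIndex.

Import GroupScope.
Variables (aT : finGroupType) (rT : finType) (to : {action aT &-> rT}).
Implicit Types (G T E : {group aT}) (S : {set rT}).

(** With [K] the stabiliser of [x] in [G], [#|S| = |G : K| = |G : KT| |KT : K|], and [|KT : K|] is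
    the index of the stabiliser in [T]. *)
Lemma normal_trans_index_dvd G T S x : T <| G -> [transitive G, on S | to] -> x \in S ->
  #|T : 'C_T[x | to]| %| #|S|.
Proof.
move=> nTG trG xS; have sTG := normal_sub nTG.
have -> : #|S| = #|G : 'C_G[x | to]| by rewrite -card_orbit (atransP trG x xS).
have nT_C : 'C_G[x | to] \subset 'N(T) := subset_trans (subsetIl _ _) (normal_norm nTG).
have sKG : 'C_G[x | to] <*> T \subset G by rewrite join_subG subsetIl.
have eI : T :&: 'C_G[x | to] = 'C_T[x | to] by rewrite setIA (setIidPl sTG).
apply/dvdnP; exists #|G : 'C_G[x | to] <*> T|.
rewrite -(Lagrange_index sKG (joing_subl _ _)); congr (_ * _)%N.
apply/eqP; rewrite -(eqn_pmul2l (cardG_gt0 'C_G[x | to])) Lagrange ?joing_subl //.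
rewrite -(eqn_pmul2r (cardG_gt0 'C_T[x | to])) /= norm_joinEl // -{1}eI setIC -mul_cardG.
by rewrite -mulnA [(_ * #|'C_T[x | to]|)%N]mulnC Lagrange ?subsetIl.
Qed.

Lemma sub_index_astab1 E T x : E \subset T ->
  #|E : 'C_E[x | to]| <= #|T : 'C_T[x | to]|.
Proof. by move=> sET; rewrite -!card_orbit; apply/subset_leq_card/imsetS. Qed.

Lemma index_le2_mulV (H G : {group aT}) x y : H \subset G -> #|G : H| <= 2 ->
  x \in G -> y \in G -> x \notin H -> y \notin H -> x * y^-1 \in H.
Proof.
move=> sHG ind2 xG yG xH yH; apply/negPn/negP=> xyH.
have eqC a b : (H :* a == H :* b) = (a * b^-1 \in H).
  by rewrite -mem_rcoset; apply/eqP/idP => [<-|/rcoset_eqP //]; apply: rcoset_refl.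
have : [set H :* 1; H :* x; H :* y] \subset rcosets H G.
  by apply/subsetP=> C; rewrite !inE => /orP[/orP[]|] /eqP->; rewrite mem_rcosets ?group1 ?mulSGid.
move/subset_leq_card/leq_trans/(_ ind2); rewrite setUC !cardsU1 cards1 !inE !eqC.
have yxH : y * x^-1 \notin H by rewrite -groupV invMg invgK.
by rewrite invg1 mulg1 mul1g groupV (negPf xH) (negPf yH) (negPf yxH).
Qed.

End TransitiveIndex.

Lemma pgroup_index_le2 (gT : finGroupType) (T H : {group gT}) k :
  (2.-group T)%g -> H \subset T -> (#|T : H|%g %| k) -> ~~ (4 %| k) -> #|T : H|%g <= 2.
Proof.
move=> T2 sHT dvk n4; have /p_natP[e Ee] : 2.-nat #|T : H|%g := pnat_dvd (dvdn_indexg T H) T2.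
rewrite Ee; case: e Ee => [|[|e]] // Ee; case/negP: n4.
by apply: dvdn_trans dvk; rewrite Ee !expnS mulnA dvdn_mulr.
Qed.

Local Open Scope ring_scope.

(** * Contradiction from a spread member with large stabiliser in [E] *)

Section SpreadStabiliser.

Import GroupScope.
Variables (F : finFieldType) (V : vectType F) (f : {biscalar V}).
Local Notation VV := (finvect_type V).
Hypothesis f_nondeg : nondegenerate_form f.
Variables (E : {group {perm VV}}) (U : {set VV}) (m : nat).
Hypotheses (ESp : E \subset Sp f) (two_neq0 : 2%:R != 0 :> F).
Hypothesis not_sqrN1 : forall a : F, (a * a != - 1)%R.
Hypotheses (E2 : 2.-group E) (exE : extraspecial E).
Hypothesis fixfreeZ : forall x, x \in 'Z(E) -> x != 1 -> fixfree x.
Hypotheses (Umod : GRing.submod_closed U) (oU : #|U| = (#|F| ^ m)%N) (m_gt0 : (0 < m)%N).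
Hypothesis dimV : \dim {:V} = (2 * m)%N.
Hypothesis U_iso : forall u v, u \in U -> v \in U -> f u v = 0%R.
Hypothesis indexZ : (4 * m ^ 2 <= #|E : 'Z(E)|)%N.
Hypothesis index_stab : (#|E : 'C_E[U | 'P^*]| <= 2)%N.
Hypothesis stabP : forall e v, e \in E -> e \notin 'C_E[U | 'P^*] ->
  v \in U -> e v \in U -> v = 0%R.

Let B := 'C_E[U | 'P^*]%G.
Let sBE : B \subset E := subsetIl _ _.
Let EL : E \subset linear_perms V.
Proof.
by apply: subset_trans ESp _; apply/subsetP=> s /SpP[sL _]; apply/linear_permsP.
Qed.
Let elin e : e \in E -> e \in linear_perms V := subsetP EL e.
Let e_iso e u v : e \in E -> f (e u) (e v) = f u v.
Proof. by move=> eE; have /SpP[_ ->] := subsetP ESp e eE. Qed.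

Let oZ : #|'Z(E)| = 2 := card_center_extraspecial E2 exE.

Let Z_sq x : x \in 'Z(E) -> x * x = 1.
Proof. by move=> xZ; have := order_dvdG xZ; rewrite oZ order_dvdn => /eqP. Qed.

(** As [x] is an involution, [v + x v] is fixed by [x], hence 0. *)
Let Z_opp x v : x \in 'Z(E) -> x != 1 -> x v = (- v)%R.
Proof.
move=> xZ x1; have xE : x \in E by case/centerP: xZ.
apply/eqP; rewrite -addr_eq0 addrC; apply/eqP/(fixfreeZ xZ x1).
by rewrite linD ?elin // -permM Z_sq // perm1 addrC.
Qed.

Let U_neq0 : exists2 v, v \in U & v != 0%R.
Proof.
by apply: submod_neq0 => //; rewrite oU -(expn0 #|F|) ltn_exp2l ?card_finNzRing_gt1.
Qed.

Let submodN v : v \in U -> (- v)%R \in U.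
Proof. by case: Umod => U0 UL vU; rewrite -[(- v)%R]addr0 -scaleN1r UL. Qed.

Let B_stable b v : b \in B -> v \in U -> b v \in U.
Proof.
case/setIP=> bE /astab1P; rewrite /= setactE => bU vU.
by rewrite -bU; apply/imsetP; exists v.
Qed.

Let sZB : 'Z(E) \subset B.
Proof.
apply/subsetP=> x xZ; have xE : x \in E by case/centerP: xZ.
rewrite inE xE; apply/astab1P; rewrite /= setactE.
have [-> | x1] := eqVneq x 1.
  by rewrite -[RHS]imset_id; apply: eq_imset => v; rewrite /= apermE perm1.
apply/setP=> v; apply/imsetP/idP=> [[u uU ->]|vU]; first by rewrite /= apermE Z_opp // submodN.
by exists (- v)%R; rewrite ?submodN //= apermE Z_opp // opprK.
Qed.

(* [B] has too many cosets of ['Z(E)] for them to be independent on [U], while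
   ['Z(B)] consists of at most two of them. *)
Lemma noncentral_scalar : exists2 y, y \in 'Z(B) :\: 'Z(E) &
  exists k : F, forall v, v \in U -> y v = (k *: v)%R.
Proof.
have B0 : (#|B|%:R != 0 :> F)%R := pgroup_natr_neq0 (pgroupS sBE E2) (isT : prime 2) two_neq0.
have comm x : x \in B -> x \notin 'Z(B) -> exists2 g, g \in B &
    [~ x, g] \in 'Z(B) /\ forall v, v \in U -> [~ x, g] v = v -> v = 0%R.
  move=> xB xNZ; have [g gB [xgZ xg1]] := extraspecial_commg exE sBE xB xNZ.
  exists g => //; split=> [|v _]; last exact: fixfreeZ.
  apply/centerP; split=> [|h hB]; first exact: subsetP sZB _ xgZ.
  by case/centerP: xgZ => _; apply; apply: subsetP sBE _ hB.
(* [4 * m ^ 2 <= |E : 'Z(E)| <= 2 * |B : 'Z(E)|] leaves a factor 2 to spare. *)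
have ltd : (m * m < #|B : 'Z(E)|)%N.
  have le2 : (#|E : B| * #|B : 'Z(E)| <= 2 * #|B : 'Z(E)|)%N by rewrite leq_mul2r index_stab orbT.
  have m2_gt0 : (0 < m ^ 2)%N by rewrite expn_gt0 m_gt0.
  have ind4 := indexZ; rewrite -(Lagrange_index sBE sZB) in ind4.
  have := leq_trans ind4 le2; rewrite -[4%N]/(2 * 2)%N -mulnA leq_pmul2l //.
  by apply: leq_trans; rewrite mulnn mul2n -addnn -addn1 leq_add2l.
have [c c1 [cinj crel]] := relation_on_center Umod (subset_trans sBE EL) B0 B_stable comm sZB oU ltd.
have ZB_sub : 'Z(B) \subset B := center_sub _.
have sZZ : 'Z(E) \subset 'Z(B).
  rewrite subsetI sZB centsC; apply: subset_trans sBE _.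
  by rewrite centsC subsetIr.
(* In an extraspecial group, ['C_E(B)] has order [|'Z(E)| |E : B|] when [B] contains ['Z(E)]. *)
have indZB : (#|'Z(B) : 'Z(E)| <= 2)%N.
  have le4 : (#|'Z(B)| <= #|'C_E(B)|)%N by rewrite subset_leq_card ?setSI.
  have := leq_trans le4 (eq_leq (card_subcent_extraspecial E2 exE sBE)).
  rewrite (setIidPl sZB) oZ -(Lagrange sZZ) oZ leq_pmul2l // => h.
  exact: leq_trans h index_stab.
have [y /and3P[yZB y1 cy]] : exists y, [&& y \in 'Z(B), y != 1 & c y != 0%R].
  have [v vU v0] := U_neq0.
  apply/existsP; apply: contraR v0 => /existsPn H; have := crel v vU.
  rewrite (bigD1 1) ?group1 //= perm1 big1 ?addr0 => [|x /andP[xZ x1]].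
    by move/eqP; rewrite scaler_eq0 (negPf c1).
  by have := H x; rewrite xZ x1 negbK => /eqP ->; rewrite scale0r.
have yNZ : y \notin 'Z(E).
  apply: contra y1 => yZ; apply/eqP/cinj => //; first exact: subsetP ZB_sub _ yZB.
  by rewrite invg1 mulg1.
exists y; first by rewrite inE yNZ.
(* Only the terms at 1 and [y] survive: any other [x] in the support lies outside ['Z(E)], so in the
   coset of [y], and equals [y]. *)
exists (- (c y)^-1 * c 1%g)%R => v vU; have := crel v vU.
rewrite (bigD1 1) ?group1 //= perm1 (bigD1 y) ?yZB //= big1 ?addr0.
  move/eqP; rewrite addrC addr_eq0 => /eqP E1.
  by rewrite mulNr scaleNr -scalerA -scalerN -E1 scalerA mulVf // scale1r.
move=> x /andP[/andP[xZ x1] xy]; have [->|cx] := eqVneq (c x) 0%R; first by rewrite scale0r.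
have xB := subsetP ZB_sub x xZ; have yB := subsetP ZB_sub y yZB.
have xNZ : x \notin 'Z(E).
  by apply: contra x1 => xZE; apply/eqP/cinj; rewrite ?invg1 ?mulg1.
by case/eqP: xy; apply: cinj => //; apply: (index_le2_mulV sZZ indZB).
Qed.

(* [y] acts as [k = 1] or [-1] on [U], since [-1] is not a square, and as [-k]
   on [g U] for any [g] not commuting with [y]; so [U] is orthogonal to
   [U + g U], which is the whole space. *)
Lemma no_spread_stabiliser : False.
Proof.
have [v0 v0U v0_neq0] := U_neq0.
have [y /setDP[/centerP[yB ycB] yNZ] [k yk]] := noncentral_scalar.
have yE := subsetP sBE y yB.
have kk : (k * k = 1)%R.
  (* The square lies in ['Phi(E) = 'Z(E)], so it acts as 1 or -1, and -1 would be the square of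
     [k]. *)
  have y2Z : y ^+ 2 \in 'Z(E).
    have [[<- _] _] := exE; rewrite (Phi_joing E2); apply: (subsetP (joing_subr _ _)).
    by rewrite -[2%N]expn1; apply: Mho_p_elt => //; apply: mem_p_elt E2 yE.
  have y2v : (y ^+ 2) v0 = (k * k *: v0)%R.
    by rewrite expgS expg1 permM yk // yk ?scalerA //; case: Umod => U0 UL; rewrite -[(_ *: _)%R]addr0 UL.
  have [y21|y2_neq1] := eqVneq (y ^+ 2) 1.
    move: y2v; rewrite y21 perm1 => /eqP; rewrite -subr_eq0 -{1}[v0]scale1r -scalerBl.
    by rewrite scaler_eq0 (negPf v0_neq0) orbF subr_eq0 => /eqP.
  move: y2v; rewrite Z_opp // => Ev; case/eqP: (not_sqrN1 k); apply/eqP; rewrite -addr_eq0.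
  have : ((k * k + 1) *: v0 == 0)%R by rewrite scalerDl scale1r -Ev addNr.
  by rewrite scaler_eq0 (negPf v0_neq0) orbF.
have [g gE [ygZ yg1]] := extraspecial_commg exE (subxx E) yE yNZ.
have gNB : g \notin B.
  by apply: contra yg1 => gB; apply/commgP/ycB.
(* [[~ y, g]] is the nonidentity element of ['Z(E)], acting as -1. *)
have ygv w : w \in U -> y (g w) = (- k *: g w)%R.
  move=> wU; rewrite -permM.
  have -> : g * y = y * g * [~ y, g].
    rewrite commgC -invg_comm; congr (_ * _); apply/eqP.
    by rewrite eq_invg_mul Z_sq.
  by rewrite (permM (y * g)) Z_opp // permM yk // linZ ?elin // scaleNr.
(* The isometry [y] multiplies this value by [- k * k = -1]. *)
have fUg u w : u \in U -> w \in U -> f u (g w) = 0%R.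
  move=> uU wU; have := e_iso u (g w) yE; rewrite yk // ygv //.
  rewrite linearZl_LR linearZr_LR /= mulrA mulrN kk mulN1r => /eqP.
  rewrite eq_sym -addr_eq0 -mulr2n -mulr_natl mulf_eq0 (negPf two_neq0) /=.
  by move/eqP.
(* [U] and [g U] meet trivially, so [h] is injective on pairs, and the [#|F| ^ (2 * m)] sums fill
   the space. *)
have v0_perp (v : VV) : f v0 v = 0%R.
  pose h (p : VV * VV) := (p.1 + g p.2)%R.
  have h_inj : {in setX U U &, injective h}.
    have subU u w : u \in U -> w \in U -> (u - w)%R \in U.
      by case: Umod => _ UL uU wU; rewrite addrC -scaleN1r UL.
    move=> [u w] [u' w'] /setXP[/= uU wU] /setXP[/= u'U w'U]; rewrite /h /= => eq_h.
    have gL := elin gE; have gw : g (w' - w)%R = (u - u')%R.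
      apply/eqP; rewrite addrC -scaleN1r linD // linZ // scaleN1r addrC.
      by rewrite eq_sym subr_eq addrAC -subr_eq opprK eq_h addrC.
    have w0 : (w' - w = 0)%R by apply: (stabP gE gNB); rewrite ?gw subU.
    have ww : w' = w by apply/eqP; rewrite -subr_eq0 w0.
    by move: eq_h; rewrite ww => /addIr ->.
  have : v \in h @: setX U U.
    suff -> : h @: setX U U = [set: VV] by rewrite inE.
    apply/eqP; rewrite eqEcard subsetT card_in_imset // cardsX oU -expnD addnn -mul2n.
    by rewrite card_finvect dimV; apply: leqnn.
  case/imsetP=> [[u w] /setXP[/= uU wU] ->].
  by rewrite /h /= linearDr /= U_iso // fUg // addr0.
by move/eqP: v0_neq0; apply; apply: f_nondeg.
Qed.

End SpreadStabiliser.

Local Close Scope ring_scope.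

(** * Arithmetic in [F] and conclusion *)

Lemma prime_natr_neq0 (F : finFieldType) s : prime s -> ~~ (s %| #|F|) -> (s%:R != 0 :> F)%R.
Proof.
move=> s_pr; apply: contraNneq => s0.
have chF : s \in [pchar F]%R by rewrite inE s_pr s0 eqxx.
rewrite (card_pprimeChar chF); have [E|lt0] := posnP (logn s #|F|); last first.
  by rewrite -{1}(expn1 s) dvdn_exp2l.
by have := card_finNzRing_gt1 F; rewrite (card_pprimeChar chF) E expn0.
Qed.

(** If [a ^+ 2 = -1], then [a ^+ 4 = 1] and [a = a ^+ #|F| = a ^+ 3 = - a], so 2 is 0 in [F],
    although [#|F|] is odd. *)
Lemma sqr_neqN1 (F : finFieldType) (a : F) : #|F| = 3 %[mod 4] -> (a * a != -1)%R.
Proof.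
move=> q3; apply/eqP=> a2; have := divn_eq #|F| 4; rewrite q3 /= => Eq.
have a_neq0 : (a != 0)%R.
  by apply: contra_eq_neq a2 => ->; rewrite mul0r eq_sym oppr_eq0 oner_eq0.
have two0 : (2%:R == 0 :> F)%R.
  have := expf_card a; rewrite Eq mulnC exprD exprM (_ : a ^+ 4 = 1)%R; last first.
    by rewrite -[4]/(2 * 2) exprM !expr2 a2 mulrNN mulr1.
  rewrite expr1n mul1r -[3 %% 4]/3 exprSr expr2 a2 mulN1r => /eqP.
  rewrite eq_sym -addr_eq0 => aa; have : (2%:R * a == 0)%R by rewrite mulr_natl mulr2n.
  by rewrite mulf_eq0 (negPf a_neq0) orbF.
have : (2%:R != 0 :> F)%R by apply: prime_natr_neq0; rewrite // Eq dvdn2 negbK oddD oddM andbF.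
by rewrite two0.
Qed.

(* [card_vspace] applies to subspaces of [finvect_type V] only: the structures
   of [V] and [finvect_type V] are not convertible for an abstract [V]. *)
Lemma card_vspace_finvect (F : finFieldType) (V : vectType F) (W : {vspace V}) :
  #|[set v : finvect_type V | (v : V) \in W]| = #|F| ^ \dim W.
Proof.
pose h (a : {ffun 'I_(\dim W) -> F}) : finvect_type V :=
  (\sum_i a i *: (vbasis W)`_i : V)%R.
have h_inj : injective h.
  move=> a b /(congr1 (fun v : V => [ffun i => coord (vbasis W) i v])) E.
  apply/ffunP=> i; move/ffunP/(_ i): E.
  by rewrite !ffunE !coord_sum_free // (basis_free (vbasisP W)).
rewrite -[X in _ ^ X]card_ord -card_ffun -(card_imset _ h_inj).
apply: eq_card => v; rewrite inE; apply/idP/imsetP=> [/coord_vbasis vE|[a _ ->]].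
  exists [ffun i => coord (vbasis W) i v] => //; rewrite /h vE.
  by apply: eq_bigr => i _; rewrite ffunE -vE.
by apply: (@rpred_sum V) => i _; rewrite rpredZ ?vbasis_mem ?memt_nth.
Qed.

Theorem theorem3p7 (p e q m : nat) (F : finFieldType) (V : vectType F)
    (f : {biscalar V}%R) (G : {group {perm finvect_type V}})
    (S : {set {set finvect_type V}})
    (p_prime : prime p) (p_odd : odd p) (e_gt0 : 0 < e) (q_def : q = p ^ e)
    (q_mod4 : q = 3 %[mod 4])
    (m_gt0 : 0 < m) (m_even : ~~ odd m)
    (cardF : #|F| = q) (dimV : \dim {:V} = 2 * m)
    (f_alt : alternating_form f) (f_nondeg : nondegenerate_form f)
    (G_Sp : G \subset Sp f) (G_sol : solvable G)
    (S_spread : complete_symplectic_spread f m S)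
    (G_trans : [transitive G, on S | 'P^*]) :
  exists r : nat, zsigmondy_prime q (2 * m) r /\
    exists R : {group {perm finvect_type V}}, (r.-Sylow(G) R)%g /\ (R <| G)%g.
Proof.
have q_odd : odd q by rewrite q_def oddX p_odd orbT.
have q_gt2 : 2 < q by case: q q_mod4 {q_def cardF q_odd} => [|[|[]]].
have q_gt0 : 0 < q := ltnW (ltnW q_gt2).
have n_gt0 : 0 < 2 * m by rewrite muln_gt0.
have n4 : 4 %| 2 * m by rewrite -[4]/(2 * 2) dvdn_pmul2l // dvdn2.
have [r rZ] := zsigmondy_exists q_gt2 q_odd n_gt0 n4; exists r; split=> //.
have [r_pr rn rmin] := rZ.
have [P sylP] := Sylow_exists r G; exists P; split=> //.
have sPG := pHall_sub sylP.
have GL : G \subset linear_perms V.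
  by apply: subset_trans G_Sp _; apply/subsetP=> s /SpP[sL _]; apply/linear_permsP.
have rP : zsigmondy_prime #|F| (\dim {:V}) r by rewrite cardF dimV.
have n_gt1 : 1 < \dim {:V} by rewrite dimV; apply: leq_trans (leq_pmulr 2 m_gt0).
have [oS S_sub S_cover S_TI] := S_spread.
(* [r] divides [(q ^ m - 1) * (q ^ m + 1)] but not the first factor; the second is [#|S|], which
   divides [#|G|] by transitivity. *)
have rG : r %| #|G|.
  apply: dvdn_trans (atrans_dvd G_trans); rewrite oS cardF.
  have := rn; rewrite mulnC expnM -[1](exp1n 2) subn_sqr exp1n Euclid_dvdM //.
  case/orP=> // rm; have := rmin m; rewrite rm m_gt0 mul2n -addnn -addn1 leq_add2l m_gt0.
  by move/(_ isT).
have rr0 : (r%:R != 0 :> F)%R.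
  apply: prime_natr_neq0 => //; rewrite cardF -prime_coprime // coprime_sym.
  exact: coprime_of_dvd_exp_sub1 rn.
have P_neq1 : P :!=: 1%g.
  by rewrite -cardG_gt1 (card_Hall sylP) p_part_gt1 mem_primes r_pr cardG_gt0.
have rgP := pHall_pgroup sylP.
have [z zZP oz] : exists2 z, z \in ('Z(P))%g & #[z]%g = r.
  have Z_neq1 : ('Z(P))%g != 1%g by rewrite center_nil_eq1 ?(pgroup_nil rgP).
  have [_ rZP _] := pgroup_pdiv (pgroupS (center_sub P) rgP) Z_neq1.
  by have [z] := Cauchy r_pr rZP; exists z.
have /centerP[zP zcP] := zZP; have zG := subsetP sPG z zP; have zL := subsetP GL z zG.
have [zF|/(not_Fitting_pcore G_sol zG)[s s_pr zNs]] := boolP (z \in 'F(G)%g).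
  apply: (Sylow_normal_of_pcore zL oz rP GL sylP zZP) rr0.
  by apply: mem_Fitting_pcore zF _; rewrite /p_elt oz pnat_id.
pose T := 'O_s(G)%G; have nTG : (T <| G)%g := pcore_normal _ _.
have TL : T \subset linear_perms V := subset_trans (normal_sub nTG) GL.
have nTz : (z \in 'N(T))%g := subsetP (normal_norm nTG) z zG.
have sT : (s.-group T)%g := pcore_pgroup _ _.
(* ['O_r(G)] lies in [P], which [z] centralises. *)
have sr : s != r.
  apply: contraNneq zNs => ->; apply/centP=> x xO; apply: zcP.
  exact: subsetP (pcore_sub_Hall sylP) x xO.
(* In characteristic [s] the group [T] would be trivial. *)
have s0 : (s%:R != 0 :> F)%R.
  apply: prime_natr_neq0 => //; apply: contra zNs => sF.
  rewrite (zsigmondy_norm_pgroup zL oz rP s_pr sF (ltnW n_gt1) TL sT nTz).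
  by apply/centP=> x /set1gP ->; apply: commute1.
have [s2 indE] := commutator_index zL oz rP n_gt1 s_pr sr s0 sT TL nTz zNs.
have exE := commutator_extraspecial zL oz rP s_pr sr s0 sT TL nTz zNs.
have ffE := commutator_center_fixfree zL oz rP s_pr sr s0 sT TL nTz.
subst s; pose E := [~: T, <[z]>]%G.
have sET : E \subset T by rewrite commg_subl cycle_subG.
have sEG : E \subset G := subset_trans sET (normal_sub nTG).
have [U US] : exists U, U \in S by apply/set0Pn; rewrite -card_gt0 oS addn1.
have [W [defU dimW W_iso]] := S_sub U US.
have inU v : (v \in U) = ((v : V) \in W) by rewrite defU inE.
exfalso; apply: (@no_spread_stabiliser F V f f_nondeg E U m) => //.
- exact: subset_trans sEG G_Sp.
- by move=> a; apply: sqr_neqN1; rewrite cardF.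
- exact: pgroupS sET sT.
- by split=> [|a u v]; rewrite !inU ?mem0v // => uW vW; rewrite memvD ?memvZ.
- by rewrite defU card_vspace_finvect dimW.
- by move=> u v; rewrite !inU; apply: W_iso.
- by rewrite indE dimV expnMn.
(* The [T]-orbit of [U] has 2-power length dividing [q ^ m + 1], which is 2 modulo 4 because [q ^ m]
   is an odd square for even [m]. *)
- apply: leq_trans (sub_index_astab1 _ _ sET) _.
  apply: pgroup_index_le2 sT (subsetIl _ _) (normal_trans_index_dvd nTG G_trans US) _.
  rewrite oS cardF -(odd_double_half m) (negPf m_even) add0n -muln2.
  rewrite expnM; have : odd (q ^ m./2) by rewrite oddX q_odd orbT.
  move: (q ^ _) => x x_odd; rewrite -(odd_double_half x) x_odd -muln2.
  have -> : (true + x./2 * 2) ^ 2 + 1 = (x./2 ^ 2 + x./2) * 4 + 2 by rewrite /=; ring.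
  by rewrite dvdn_addr //; apply: dvdn_mull.
(* [g U] is another member of the spread, so it meets [U] only in 0. *)
move=> g v gE gNstab vU gvU; have gG := subsetP sEG g gE.
have gU_S : ('P^*)%act U g \in S by rewrite (acts_act (atrans_acts G_trans)).
have neq : U != ('P^*)%act U g.
  by apply: contra gNstab => /eqP E1; rewrite inE gE; apply/astab1P.
have : g v \in U :&: ('P^*)%act U g.
  by rewrite inE gvU /= setactE; apply/imsetP; exists v.
rewrite S_TI // => /set1P gv0; apply: (@perm_inj _ g).
by rewrite gv0 lin0 ?(subsetP GL).
Qed.
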